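(* Let $\mathfrak{S}_\infty$ be the group of permutations with finite support of the infinite set $\mathbb{N}^*=\{1,2,\ldots\}$. There is an extension $$1\to P_\infty^{\mathrm{ab}}\to B_\infty/[P_\infty,P_\infty]\xrightarrow{\,p\,}\mathfrak{S}_\infty\to 1,$$ where $P_\infty^{\mathrm{ab}}=P_\infty/[P_\infty,P_\infty]$ identifies with the free abelian group on the set $\mathscr{P}_2$ of $2$-element subsets of $\mathbb{N}^*$. Every finite subgroup of $B_\infty/[P_\infty,P_\infty]$ is of odd order and is mapped by $p$ isomorphically onto its image in $\mathfrak{S}_\infty$. For every finite subgroup $G$ of $\mathfrak{S}_\infty$ of odd order, there exists a group homomorphism $s\colon G\to B_\infty/[P_\infty,P_\infty]$ such that $p\circ s=\mathrm{id}_G$. Moreover, any two such group homomorphisms are conjugate by an element of $P_\infty^{\mathrm{ab}}$. Finally, for every finite subgroup $\widetilde{G}$ of $B_\infty/[P_\infty,P_\infty]$, the intersection of the normalizer of $\widetilde{G}$ in $B_\infty/[P_\infty,P_\infty]$ with $P_\infty^{\mathrm{ab}}$ is isomorphic to the free abelian group $\mathbb{Z}[\mathscr{P}_2/p(\widetilde{G})]$ on the set of orbits of $p(\widetilde{G})$ in $\mathscr{P}_2$.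
   Context: For $n\in\mathbb{N}$, $B_n$ is the standard (Artin) braid group on $n$ strands and $P_n$ is the pure braid group on $n$ strands, i.e. the kernel of the natural map $B_n\to\mathfrak{S}_n$ to the symmetric group. $B_\infty$ is the direct limit of the groups $B_n$ along the maps $B_n\to B_{n+1}$ adding one strand on the right, and $P_\infty\subset B_\infty$ is the direct limit of the groups $P_n$ along the same maps. $\mathfrak{S}_\infty$ is the direct limit of the groups $\mathfrak{S}_n$, where $\mathfrak{S}_{n-1}\subset\mathfrak{S}_n$ consists of the permutations fixing $n$; the map $p$ is induced by the natural maps $B_n\to\mathfrak{S}_n$. *)

(* Defs.v *)
From HB Require Import structures.
From mathcomp Require Import all_boot all_order all_algebra.
From mathcomp Require Import fingroup perm generic_quotient finmap.
From mathcomp Require Import boolp classical_sets functions cardinality.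
From mathcomp Require Import zify.
From mathcomp.multinomials Require Import freeg.

Set Implicit Arguments.
Unset Strict Implicit.
Unset Printing Implicit Defensive.

Import GRing.Theory.

Local Open Scope classical_set_scope.
Local Open Scope quotient_scope.
Local Open Scope group_scope.

Record subgroup (G : groupType) := Subgroup {
  subgroup_pred :> {pred G};
  subgroup_closed : group_closed subgroup_pred
}.

Record normal_subgroup (G : groupType) := NormalSubgroup {
  normal_pred :> subgroup G;
  normal_closed : forall x y : G, x \in normal_pred -> x ^ y \in normal_pred
}.

Section SubgroupTheory.
Variables (G : groupType) (S : subgroup G).

Lemma sub1g : 1 \in S. Proof. exact: (subgroup_closed S).1. Qed.

Lemma subVg x : x \in S -> x^-1 \in S.
Proof. exact: (group_closedV (subgroup_closed S)). Qed.

Lemma subMg x y : x \in S -> y \in S -> x * y \in S.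
Proof. exact: (group_closedM (subgroup_closed S)). Qed.

Definition subgroup_of : Type := {x : G | x \in S}.

HB.instance Definition _ := SubChoice.on subgroup_of.

Fact subgroup_of_closed : group_closed (fun x : G => x \in S).
Proof. exact: subgroup_closed. Qed.

HB.instance Definition _ :=
  SubChoice_isSubGroup.Build G (fun x : G => x \in S) subgroup_of
    subgroup_of_closed.

End SubgroupTheory.

Section Constructions.
Variable G : groupType.
Implicit Types (S T : subgroup G) (N : normal_subgroup G).

Lemma group_closedP (A : {pred G}) :
    1 \in A -> (forall x y, x \in A -> y \in A -> x * y \in A) ->
    (forall x, x \in A -> x^-1 \in A) ->
  group_closed A.
Proof. by move=> A1 AM AV; split => // x y Ax Ay; apply: AM => //; apply: AV. Qed.

Definition generated_pred (A : set G) : {pred G} :=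
  fun x => `[< forall S, A `<=` [set` S] -> x \in S >].

Fact generated_closed A : group_closed (generated_pred A).
Proof.
apply: group_closedP => [|x y /asboolP Ax /asboolP Ay|x /asboolP Ax];
  apply/asboolP => S AS; first exact: sub1g.
- by apply: subMg; [exact: Ax | exact: Ay].
- by apply: subVg; exact: Ax.
Qed.

Definition generated (A : set G) := Subgroup (generated_closed A).

Definition commutators (A B : {pred G}) : set G :=
  [set [~ x, y] | x in [set` A] & y in [set` B]].

Fact conj_preim_closed S (z : G) : group_closed (fun x => x ^ z \in S : bool).
Proof.
apply: group_closedP => [|x y|x]; rewrite !unfold_in.
- by rewrite conj1g; exact: sub1g.
- by rewrite conjMg; exact: subMg.
- by rewrite conjVg; exact: subVg.
Qed.

Fact derived_normal N (x y : G) :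
  x \in generated (commutators N N) -> x ^ y \in generated (commutators N N).
Proof.
move=> /asboolP Nx; apply/asboolP => S NS.
apply: (Nx (Subgroup (conj_preim_closed S y))) => _ [a Na] [b Nb <-] /=.
rewrite unfold_in conjRg; apply: NS.
by exists (a ^ y); [exact: normal_closed | exists (b ^ y) => //; exact: normal_closed].
Qed.

Definition derived N := NormalSubgroup (@derived_normal N).

Definition normalizer_pred S : {pred G} :=
  fun x => `[< [set y ^ x | y in [set` S]] = [set` S] >].

Fact normalizer_closed S : group_closed (normalizer_pred S).
Proof.
have NP x : reflect (forall y, (y ^ x \in S) = (y \in S))
                    (x \in normalizer_pred S).
  apply: (iffP (asboolP _)) => [eS y|eS].
    apply/idP/idP => Sy.
      have : [set` S] (y ^ x) by [].
      by rewrite -eS => -[z /= Sz /conjg_inj <-].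
    have : [set y ^ x | y in [set` S]] (y ^ x) by exists y.
    by rewrite eS.
  apply/seteqP; split => [_ [y /= Sy <-]|y /= Sy]; first by rewrite /= eS.
  by exists (y ^ x^-1); rewrite ?conjgKV //= -eS conjgKV.
apply: group_closedP => [|x y /NP Nx /NP Ny|x /NP Nx]; apply/NP => z.
- by rewrite conjg1.
- by rewrite conjgM Ny Nx.
- by rewrite -(Nx (z ^ x^-1)) conjgKV.
Qed.

Definition normalizer S := Subgroup (normalizer_closed S).

Fact inter_closed S T : group_closed [predI S & T].
Proof.
apply: group_closedP => [|x y /andP[Sx Tx] /andP[Sy Ty]|x /andP[Sx Tx]].
- by rewrite inE !sub1g.
- by rewrite inE !subMg.
- by rewrite inE !subVg.
Qed.

Definition inter_subgroup S T := Subgroup (inter_closed S T).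

End Constructions.

Section Morphisms.
Variables (G H : groupType) (f : {multiplicative G -> H}).

Lemma mult1 : f 1 = 1.
Proof. by apply: (mulgI (f 1)); rewrite -gmulfM !mulg1. Qed.

Lemma multV x : f x^-1 = (f x)^-1.
Proof. by apply: (mulgI (f x)); rewrite -gmulfM !mulgV mult1. Qed.

Fact kernel_closed : group_closed [pred x | f x == 1].
Proof.
apply: group_closedP => [|x y|x]; rewrite !inE ?mult1 // ?gmulfM ?multV.
- by move=> /eqP-> /eqP->; rewrite mulg1.
- by move=> /eqP->; rewrite invg1.
Qed.

Definition kernel := Subgroup kernel_closed.

Fact kernel_normal x y : x \in kernel -> x ^ y \in kernel.
Proof.
by rewrite !inE conjgE !gmulfM multV => /eqP->; rewrite mul1g mulVg.
Qed.

Definition image_pred (S : subgroup G) : {pred H} :=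
  fun y => `[< exists2 x, x \in S & f x = y >].

Fact image_closed S : group_closed (image_pred S).
Proof.
apply: group_closedP => [|_ _ /asboolP[x Sx <-] /asboolP[y Sy <-]|
                         _ /asboolP[x Sx <-]]; apply/asboolP.
- by exists 1; [exact: sub1g | exact: mult1].
- by exists (x * y); [exact: subMg | exact: gmulfM].
- by exists x^-1; [exact: subVg | exact: multV].
Qed.

Definition image_subgroup S := Subgroup (image_closed S).

End Morphisms.

Section QuotientGroup.
Variables (G : groupType) (N : normal_subgroup G).

Definition quot_rel (x y : G) : bool := x * y^-1 \in N.

Fact quot_rel_refl : reflexive quot_rel.
Proof. by move=> x; rewrite /quot_rel mulgV sub1g. Qed.

Fact quot_rel_sym : symmetric quot_rel.
Proof.
suff W x y : quot_rel x y -> quot_rel y x by move=> x y; apply/idP/idP; exact: W.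
by move=> /subVg; rewrite /quot_rel invgM invgK.
Qed.

Fact quot_rel_trans : transitive quot_rel.
Proof.
move=> y x z Nxy Nyz; rewrite /quot_rel -(mulgVK y x) -mulgA.
exact: subMg.
Qed.

Canonical quot_equiv :=
  EquivRel quot_rel quot_rel_refl quot_rel_sym quot_rel_trans.

Definition quot_group : Type := {eq_quot quot_rel}.

HB.instance Definition _ := Choice.on quot_group.
HB.instance Definition _ := EqQuotient.on quot_group.

Definition quot_pi (x : G) : quot_group := \pi_quot_group x.

Lemma quot_piP x y : reflect (quot_pi x = quot_pi y) (x * y^-1 \in N).
Proof. exact: (@eqmodP _ quot_equiv x y). Qed.

Lemma quot_reprK (u : quot_group) : quot_pi (repr u) = u.
Proof. exact: reprK. Qed.

Definition quot_one : quot_group := quot_pi 1.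
Definition quot_mul (u v : quot_group) := quot_pi (repr u * repr v).
Definition quot_inv (u : quot_group) := quot_pi (repr u)^-1.

Lemma quot_mulE x y : quot_mul (quot_pi x) (quot_pi y) = quot_pi (x * y).
Proof.
have /quot_piP Nx := quot_reprK (quot_pi x).
have /quot_piP Ny := quot_reprK (quot_pi y).
apply/quot_piP; rewrite invgM mulgA -(mulgA (repr _)).
set a := repr (quot_pi x) in Nx *; set b := _ * y^-1 in Ny *.
have -> : a * b / x = (b ^ a^-1) * (a / x) by rewrite conjgE invgK !mulgA mulgVK.
by apply: subMg => //; apply: normal_closed.
Qed.

Lemma quot_invE x : quot_inv (quot_pi x) = quot_pi x^-1.
Proof.
have /quot_piP Nx := quot_reprK (quot_pi x); apply/quot_piP; rewrite invgK.
set a := repr (quot_pi x) in Nx *.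
have -> : a^-1 * x = (a / x)^-1 ^ a by rewrite invgM invgK conjgE mulgVK.
by apply: normal_closed; apply: subVg.
Qed.

Fact quot_mulA : associative quot_mul.
Proof.
move=> u v w; rewrite -(quot_reprK u) -(quot_reprK v) -(quot_reprK w).
by rewrite !quot_mulE mulgA.
Qed.
Fact quot_mul1 : left_id quot_one quot_mul.
Proof. by move=> u; rewrite -(quot_reprK u) quot_mulE mul1g. Qed.
Fact quot_1mul : right_id quot_one quot_mul.
Proof. by move=> u; rewrite -(quot_reprK u) quot_mulE mulg1. Qed.
Fact quot_mulV : left_inverse quot_one quot_inv quot_mul.
Proof. by move=> u; rewrite -(quot_reprK u) quot_invE quot_mulE mulVg. Qed.
Fact quot_Vmul : right_inverse quot_one quot_inv quot_mul.
Proof. by move=> u; rewrite -(quot_reprK u) quot_invE quot_mulE mulgV. Qed.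

HB.instance Definition _ := isGroup.Build quot_group
  quot_mulA quot_mul1 quot_1mul quot_mulV quot_Vmul.

Fact quot_piM : {morph quot_pi : x y / x * y}.
Proof. by move=> x y; rewrite -quot_mulE. Qed.

HB.instance Definition _ := isMultiplicative.Build G quot_group quot_pi quot_piM.

Variables (H : groupType) (f : {multiplicative G -> H}).

Definition quot_hom (fN : forall x, x \in N -> f x = 1) (u : quot_group) : H :=
  f (repr u).

Hypothesis fN : forall x, x \in N -> f x = 1.

Lemma quot_homE x : quot_hom fN (quot_pi x) = f x.
Proof.
have /quot_piP/fN := quot_reprK (quot_pi x).
by rewrite gmulfM multV => /divg1_eq.
Qed.

Fact quot_homM : {morph quot_hom fN : u v / u * v}.
Proof.
move=> u v; rewrite -(quot_reprK u) -(quot_reprK v) -quot_piM.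
by rewrite !quot_homE gmulfM.
Qed.

HB.instance Definition _ :=
  isMultiplicative.Build quot_group H (quot_hom fN) quot_homM.

End QuotientGroup.

Section PresentedGroup.
Variables (T : choiceType).

(* The letter [(x, true)] stands for the generator [x], [(x, false)] for its
   inverse. *)
Definition word := seq (T * bool).

Definition inv_letter (l : T * bool) := (l.1, ~~ l.2).

Definition inv_word (w : word) : word := rev (map inv_letter w).

Variable R : word -> word -> Prop.

Inductive pres_eq : word -> word -> Prop :=
| PresRel u v : R u v -> pres_eq u v
| PresInv l : pres_eq [:: l; inv_letter l] [::]
| PresCat u u' v v' : pres_eq u u' -> pres_eq v v' -> pres_eq (u ++ v) (u' ++ v')
| PresRefl u : pres_eq u u
| PresSym u v : pres_eq u v -> pres_eq v u
| PresTrans u v w : pres_eq u v -> pres_eq v w -> pres_eq u w.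

Definition pres_rel (u v : word) : bool := `[< pres_eq u v >].

Fact pres_rel_refl : reflexive pres_rel.
Proof. by move=> u; apply/asboolP; exact: PresRefl. Qed.

Fact pres_rel_sym : symmetric pres_rel.
Proof. by move=> u v; apply/idP/idP => /asboolP/PresSym/asboolP. Qed.

Fact pres_rel_trans : transitive pres_rel.
Proof.
by move=> v u w /asboolP uv /asboolP vw; apply/asboolP; exact: PresTrans uv vw.
Qed.

Canonical pres_equiv :=
  EquivRel pres_rel pres_rel_refl pres_rel_sym pres_rel_trans.

Definition pres_group : Type := {eq_quot pres_rel}.

HB.instance Definition _ := Choice.on pres_group.
HB.instance Definition _ := EqQuotient.on pres_group.

Definition pres_pi (w : word) : pres_group := \pi_pres_group w.

Lemma pres_piP u v : pres_pi u = pres_pi v <-> pres_eq u v.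
Proof.
split => [/(@eqmodP _ pres_equiv u v)/asboolP //|uv].
by apply/(@eqmodP _ pres_equiv u v)/asboolP.
Qed.

Lemma pres_reprK (x : pres_group) : pres_pi (repr x) = x.
Proof. exact: reprK. Qed.

Lemma inv_letterK : involutive inv_letter.
Proof. by case=> x b; rewrite /inv_letter /= negbK. Qed.

Lemma inv_wordK : involutive inv_word.
Proof. by move=> w; rewrite /inv_word map_rev revK mapK //; exact: inv_letterK. Qed.

Lemma inv_word_cat u v : inv_word (u ++ v) = inv_word v ++ inv_word u.
Proof. by rewrite /inv_word map_cat rev_cat. Qed.

Lemma pres_eq_mulV w : pres_eq (w ++ inv_word w) [::].
Proof.
elim: w => [|l w IHw] /=; first exact: PresRefl.
rewrite -cat1s -[l :: w]cat1s inv_word_cat.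
apply: (@PresTrans _ ([:: l] ++ inv_word [:: l])); last exact: PresInv.
apply: PresCat; first exact: PresRefl.
rewrite catA -[X in pres_eq _ X]cat0s; apply: PresCat => //; exact: PresRefl.
Qed.

Lemma pres_eq_Vmul w : pres_eq (inv_word w ++ w) [::].
Proof. by have := pres_eq_mulV (inv_word w); rewrite inv_wordK. Qed.

Lemma pres_eq_inv u v : pres_eq u v -> pres_eq (inv_word u) (inv_word v).
Proof.
move=> uv; apply: (@PresTrans _ (inv_word u ++ v ++ inv_word v)).
  rewrite -[X in pres_eq X _]cats0; apply: PresCat; first exact: PresRefl.
  exact/PresSym/pres_eq_mulV.
rewrite catA -[X in pres_eq _ X]cat0s; apply: PresCat; last exact: PresRefl.
apply: PresTrans (pres_eq_Vmul u); apply: PresCat; first exact: PresRefl.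
exact: PresSym.
Qed.

Definition pres_one := pres_pi [::].
Definition pres_mul (x y : pres_group) := pres_pi (repr x ++ repr y).
Definition pres_inv (x : pres_group) := pres_pi (inv_word (repr x)).

Lemma pres_mulE u v : pres_mul (pres_pi u) (pres_pi v) = pres_pi (u ++ v).
Proof. by apply/pres_piP; apply: PresCat; apply/pres_piP/pres_reprK. Qed.

Lemma pres_invE u : pres_inv (pres_pi u) = pres_pi (inv_word u).
Proof. by apply/pres_piP/pres_eq_inv/pres_piP/pres_reprK. Qed.

Fact pres_mulA : associative pres_mul.
Proof.
move=> u v w; rewrite -(pres_reprK u) -(pres_reprK v) -(pres_reprK w).
by rewrite !pres_mulE catA.
Qed.
Fact pres_mul1 : left_id pres_one pres_mul.
Proof. by move=> u; rewrite -(pres_reprK u) pres_mulE. Qed.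
Fact pres_1mul : right_id pres_one pres_mul.
Proof. by move=> u; rewrite -(pres_reprK u) pres_mulE cats0. Qed.
Fact pres_mulV : left_inverse pres_one pres_inv pres_mul.
Proof.
move=> u; rewrite -(pres_reprK u) pres_invE pres_mulE.
exact/pres_piP/pres_eq_Vmul.
Qed.
Fact pres_Vmul : right_inverse pres_one pres_inv pres_mul.
Proof.
move=> u; rewrite -(pres_reprK u) pres_invE pres_mulE.
exact/pres_piP/pres_eq_mulV.
Qed.

HB.instance Definition _ := isGroup.Build pres_group
  pres_mulA pres_mul1 pres_1mul pres_mulV pres_Vmul.

Definition pres_gen (x : T) : pres_group := pres_pi [:: (x, true)].

Section Lift.
Variables (H : groupType) (f : T -> H).

Definition eval_letter (l : T * bool) : H := if l.2 then f l.1 else (f l.1)^-1.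

Definition eval_word (w : word) : H := foldr (fun l h => eval_letter l * h) 1 w.

Definition pres_hom (fR : forall u v, R u v -> eval_word u = eval_word v)
  (x : pres_group) : H := eval_word (repr x).

Lemma eval_word_cat u v : eval_word (u ++ v) = eval_word u * eval_word v.
Proof. by elim: u => [|l u IHu] /=; rewrite ?mul1g // IHu mulgA. Qed.

Hypothesis fR : forall u v, R u v -> eval_word u = eval_word v.

Lemma eval_word_eq u v : pres_eq u v -> eval_word u = eval_word v.
Proof.
elim=> {u v} [u v|[x []]|u u' v v' _ eu _ ev|||u v w _ -> _ ->] //.
- exact: fR.
- by rewrite /= /eval_letter /= mulg1 mulgV.
- by rewrite /= /eval_letter /= mulg1 mulVg.
- by rewrite !eval_word_cat eu ev.
Qed.

Lemma pres_hom_pi u : pres_hom fR (pres_pi u) = eval_word u.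
Proof. exact/eval_word_eq/pres_piP/pres_reprK. Qed.

Lemma pres_hom_gen x : pres_hom fR (pres_gen x) = f x.
Proof. by rewrite pres_hom_pi /= mulg1. Qed.

Fact pres_homM : {morph pres_hom fR : x y / x * y}.
Proof.
move=> x y; rewrite -(pres_reprK x) -(pres_reprK y) [_ * _]pres_mulE.
by rewrite !pres_hom_pi eval_word_cat.
Qed.

HB.instance Definition _ :=
  isMultiplicative.Build pres_group H (pres_hom fR) pres_homM.

End Lift.
End PresentedGroup.

Lemma eval_word_gen (T U : choiceType) (R : word T -> word T -> Prop)
    (e : U -> T) (w : word U) :
  eval_word (fun x => pres_gen R (e x)) w = pres_pi R [seq (e l.1, l.2) | l <- w].
Proof.
elim: w => [|[x b] w IHw] //=; rewrite IHw /eval_letter /=.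
case: b; first by rewrite [LHS]pres_mulE.
by rewrite [_^-1]pres_invE [LHS]pres_mulE.
Qed.

Lemma mult_eval_word (T : choiceType) (G H : groupType)
    (h : {multiplicative G -> H}) (f : T -> G) (w : word T) :
  h (eval_word f w) = eval_word (fun x => h (f x)) w.
Proof.
elim: w => [|[x b] w IHw] /=; first exact: mult1.
by rewrite gmulfM IHw /eval_letter /=; case: b; rewrite ?multV.
Qed.

Lemma eq_eval_word (T : choiceType) (H : groupType) (f g : T -> H) :
  f =1 g -> eval_word f =1 eval_word g.
Proof. by move=> fg; elim=> [|[x b] w IHw] //=; rewrite IHw /eval_letter fg. Qed.

Section DirectLimit.
Variables (G : nat -> groupType) (f : forall n, {multiplicative G n -> G n.+1}).

(* For n <= m, the composite G n -> G n.+1 -> ... -> G m of the maps f; the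
   value is the junk 1 when n > m. *)
Fixpoint shift n m : G n -> G m :=
  match m return G n -> G m with
  | 0 => fun x =>
      if n =P 0%N is ReflectT e then ecast k (G k) e x else 1
  | m'.+1 => fun x =>
      if n =P m'.+1 is ReflectT e then ecast k (G k) e x else f m' (shift m' x)
  end.

Lemma shift_id n (x : G n) : shift n x = x.
Proof.
by case: n x => [|n] x /=; case: eqP => // e; rewrite (eq_irrelevance e erefl).
Qed.

Lemma shiftS n m (x : G n) : n <= m -> shift m.+1 x = f m (shift m x).
Proof. by move=> nm /=; case: eqP => // e; rewrite e ltnn in nm. Qed.

Lemma shift_trans n m k (x : G n) :
  n <= m -> m <= k -> shift k (shift m x) = shift k x.
Proof.
move=> nm; elim: k => [|k IHk] mk.
  by move: mk; rewrite leqn0 => /eqP m0; subst m; rewrite shift_id.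
move: mk; rewrite leq_eqVlt => /predU1P[mk|mk]; first by subst m; rewrite shift_id.
by rewrite !shiftS ?IHk //; exact: leq_trans nm _.
Qed.

Lemma shiftM n m : {morph @shift n m : x y / x * y}.
Proof.
elim: m => [|m IHm] x y /=; case: eqP => e.
- by subst n.
- by rewrite mulg1.
- by subst n.
- by rewrite IHm gmulfM.
Qed.

Lemma shift1 n m : @shift n m 1 = 1.
Proof. by apply: (mulgI (@shift n m 1)); rewrite -shiftM !mulg1. Qed.

Lemma shiftV n m (x : G n) : @shift n m x^-1 = (shift m x)^-1.
Proof. by apply: (mulgI (shift m x)); rewrite -shiftM !mulgV shift1. Qed.

Definition dlim_rel (u v : {n : nat & G n}) : bool :=
  `[< exists m, [/\ tag u <= m, tag v <= m &
                    shift m (tagged u) = shift m (tagged v)] >].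

Fact dlim_rel_refl : reflexive dlim_rel.
Proof. by move=> u; apply/asboolP; exists (tag u). Qed.

Fact dlim_rel_sym : symmetric dlim_rel.
Proof.
by move=> u v; apply/idP/idP => /asboolP[m [um vm e]]; apply/asboolP; exists m.
Qed.

Fact dlim_rel_trans : transitive dlim_rel.
Proof.
move=> v u w /asboolP[m [um vm euv]] /asboolP[k [vk wk evw]].
apply/asboolP; exists (maxn m k).
have mM := leq_maxl m k; have kM := leq_maxr m k.
split; [exact: leq_trans mM | exact: leq_trans kM |].
rewrite -(shift_trans _ um mM) euv shift_trans //.
by rewrite -(shift_trans _ vk kM) evw shift_trans.
Qed.

Canonical dlim_equiv :=
  EquivRel dlim_rel dlim_rel_refl dlim_rel_sym dlim_rel_trans.

Definition dlim : Type := {eq_quot dlim_rel}.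

HB.instance Definition _ := Choice.on dlim.
HB.instance Definition _ := EqQuotient.on dlim.

Definition dlim_in n (x : G n) : dlim := \pi_dlim (Tagged G x).

Lemma dlim_inP n m (x : G n) (y : G m) : dlim_in x = dlim_in y <->
  exists k, [/\ n <= k, m <= k & shift k x = shift k y].
Proof.
split=> [/(@eqmodP _ dlim_equiv)/asboolP //|e].
by apply/(@eqmodP _ dlim_equiv)/asboolP.
Qed.

Lemma dlim_in_shift n m (x : G n) : n <= m -> dlim_in (shift m x) = dlim_in x.
Proof. by move=> nm; apply/dlim_inP; exists m; split; rewrite // shift_id. Qed.

Lemma dlim_reprK (u : dlim) : dlim_in (tagged (repr u)) = u.
Proof. by rewrite -[RHS]reprK /dlim_in; case: (repr u). Qed.

Lemma dlimP (u : dlim) m0 : exists2 m, m0 <= m & exists x : G m, u = dlim_in x.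
Proof.
exists (maxn m0 (tag (repr u))); first exact: leq_maxl.
exists (shift _ (tagged (repr u))).
by rewrite dlim_in_shift ?dlim_reprK ?leq_maxr.
Qed.

Definition dlim_one : dlim := dlim_in (1 : G 0).

Definition dlim_mul (u v : dlim) : dlim :=
  let m := maxn (tag (repr u)) (tag (repr v)) in
  dlim_in (shift m (tagged (repr u)) * shift m (tagged (repr v))).

Definition dlim_inv (u : dlim) : dlim := dlim_in (tagged (repr u))^-1.

Lemma dlim_mulE n (x y : G n) :
  dlim_mul (dlim_in x) (dlim_in y) = dlim_in (x * y).
Proof.
have /dlim_inP[k [uk nk ex]] := dlim_reprK (dlim_in x).
have /dlim_inP[l [vl nl ey]] := dlim_reprK (dlim_in y).
rewrite /dlim_mul; set u := repr _ in uk ex *; set v := repr _ in vl ey *.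
have kM := leq_maxl k l; have lM := leq_maxr k l.
have uvM : maxn (tag u) (tag v) <= maxn k l.
  by rewrite geq_max (leq_trans uk kM) (leq_trans vl lM).
apply/dlim_inP; exists (maxn k l); split => //; first exact: leq_trans kM.
rewrite !shiftM !shift_trans ?leq_maxl ?leq_maxr //.
rewrite -(shift_trans _ uk kM) ex shift_trans //.
by rewrite -(shift_trans (tagged v) vl lM) ey shift_trans.
Qed.

Lemma dlim_invE n (x : G n) : dlim_inv (dlim_in x) = dlim_in x^-1.
Proof.
have /dlim_inP[k [uk nk ex]] := dlim_reprK (dlim_in x).
by apply/dlim_inP; exists k; split; rewrite // !shiftV ex.
Qed.

Lemma dlim_in1 n : dlim_in (1 : G n) = dlim_one.
Proof. by rewrite -(@shift1 0 n) dlim_in_shift. Qed.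

Lemma dlim_ind3 (P : dlim -> dlim -> dlim -> Prop) :
  (forall n (x y z : G n), P (dlim_in x) (dlim_in y) (dlim_in z)) ->
  forall u v w, P u v w.
Proof.
move=> PG u v w; have [n _ [x ->]] := dlimP u 0.
have [m nm [y ->]] := dlimP v n; have [k mk [z ->]] := dlimP w m.
by rewrite -(dlim_in_shift y mk) -(dlim_in_shift x (leq_trans nm mk)).
Qed.

Fact dlim_mulA : associative dlim_mul.
Proof. by apply: dlim_ind3 => n x y z; rewrite !dlim_mulE mulgA. Qed.
Fact dlim_mul1 : left_id dlim_one dlim_mul.
Proof.
move=> u; have [n _ [x ->]] := dlimP u 0.
by rewrite -(dlim_in1 n) dlim_mulE mul1g.
Qed.
Fact dlim_1mul : right_id dlim_one dlim_mul.
Proof.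
move=> u; have [n _ [x ->]] := dlimP u 0.
by rewrite -(dlim_in1 n) dlim_mulE mulg1.
Qed.
Fact dlim_mulV : left_inverse dlim_one dlim_inv dlim_mul.
Proof.
move=> u; have [n _ [x ->]] := dlimP u 0.
by rewrite dlim_invE dlim_mulE mulVg dlim_in1.
Qed.
Fact dlim_Vmul : right_inverse dlim_one dlim_inv dlim_mul.
Proof.
move=> u; have [n _ [x ->]] := dlimP u 0.
by rewrite dlim_invE dlim_mulE mulgV dlim_in1.
Qed.

HB.instance Definition _ := isGroup.Build dlim
  dlim_mulA dlim_mul1 dlim_1mul dlim_mulV dlim_Vmul.

Fact dlim_inM n : {morph @dlim_in n : x y / x * y}.
Proof. by move=> x y; rewrite -dlim_mulE. Qed.

HB.instance Definition _ n :=
  isMultiplicative.Build (G n) dlim (@dlim_in n) (@dlim_inM n).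

Section Lift.
Variables (H : groupType) (h : forall n, {multiplicative G n -> H}).

Definition dlim_hom (hf : forall n x, h n.+1 (f n x) = h n x) (u : dlim) : H :=
  h (tag (repr u)) (tagged (repr u)).

Hypothesis hf : forall n x, h n.+1 (f n x) = h n x.

Lemma dlim_hom_shift n m (x : G n) : n <= m -> h m (shift m x) = h n x.
Proof.
elim: m => [|m IHm]; first by rewrite leqn0 => /eqP n0; subst n; rewrite shift_id.
rewrite leq_eqVlt => /predU1P[nm|nm]; first by subst n; rewrite shift_id.
by rewrite shiftS // hf IHm.
Qed.

Lemma dlim_hom_in n (x : G n) : dlim_hom hf (dlim_in x) = h n x.
Proof.
have /dlim_inP[k [uk nk ex]] := dlim_reprK (dlim_in x).
by rewrite /dlim_hom -(dlim_hom_shift _ uk) ex dlim_hom_shift.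
Qed.

Fact dlim_homM : {morph dlim_hom hf : u v / u * v}.
Proof.
move=> u v; have [n _ [x ->]] := dlimP u 0; have [m nm [y ->]] := dlimP v n.
by rewrite -(dlim_in_shift x nm) -dlim_inM !dlim_hom_in gmulfM.
Qed.

HB.instance Definition _ :=
  isMultiplicative.Build dlim H (dlim_hom hf) dlim_homM.

End Lift.
End DirectLimit.

(* The points 1, 2, ... of the infinite set are numbered from 0, as the points of
   ['I_n] are; products are read from left to right, as in [{perm T}]. *)

Definition finsupp_perm (s : nat -> nat) : bool :=
  `[< bijective s /\ finite_set [set i | s i <> i] >].

Definition Sinf : Type := {s : nat -> nat | finsupp_perm s}.

HB.instance Definition _ := SubChoice.on Sinf.

Definition Sinf_fun (s : Sinf) : nat -> nat := sval s.
Coercion Sinf_fun : Sinf >-> Funclass.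

Section SinfGroup.
Implicit Types s t : Sinf.

Lemma Sinf_bij s : bijective s. Proof. by have /asboolP[] := valP s. Qed.

Lemma Sinf_inj s : injective s. Proof. exact: bij_inj (Sinf_bij s). Qed.

Lemma Sinf_fin s : finite_set [set i | s i <> i].
Proof. by have /asboolP[] := valP s. Qed.

Lemma SinfP s t : s =1 t -> s = t.
Proof. by move=> st; apply: val_inj; apply: funext. Qed.

Fact Sinf_one_proof : finsupp_perm id.
Proof.
apply/asboolP; split; first by exists id.
by rewrite (_ : [set _ | _] = set0) //; apply/seteqP; split => // i /=.
Qed.

Definition Sinf_one : Sinf := exist _ id Sinf_one_proof.

Fact Sinf_mul_proof s t : finsupp_perm (t \o s).
Proof.
apply/asboolP; split; first by apply: bij_comp; exact: Sinf_bij.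
have /sub_finite_set : [set i | (t \o s) i <> i] `<=`
    [set i | s i <> i] `|` [set i | t i <> i].
  move=> i /= tsi; have [si|] := eqVneq (s i) i; last by move=> /eqP; left.
  by right; rewrite /= -{1}si.
by apply; rewrite finite_setU; split; exact: Sinf_fin.
Qed.

Definition Sinf_mul s t : Sinf := exist _ (t \o s) (Sinf_mul_proof s t).

Fact Sinf_surj s i : exists j, s j == i.
Proof. by have [t _ tK] := Sinf_bij s; exists (t i); rewrite tK. Qed.

Definition Sinf_inv_fun s i := xchoose (Sinf_surj s i).

Lemma Sinf_inv_funK s : cancel (Sinf_inv_fun s) s.
Proof. by move=> i; apply/eqP/(xchooseP (Sinf_surj s i)). Qed.

Lemma Sinf_funK s : cancel s (Sinf_inv_fun s).
Proof. by move=> i; apply: (@Sinf_inj s); rewrite Sinf_inv_funK. Qed.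

Fact Sinf_inv_proof s : finsupp_perm (Sinf_inv_fun s).
Proof.
apply/asboolP; split.
  by exists s; [exact: Sinf_inv_funK | exact: Sinf_funK].
apply: sub_finite_set (Sinf_fin s) => i /= si; apply: contra_not si => {1}<-.
by rewrite Sinf_funK.
Qed.

Definition Sinf_inv s : Sinf := exist _ (Sinf_inv_fun s) (Sinf_inv_proof s).

Fact Sinf_mulA : associative Sinf_mul. Proof. by move=> s t u; exact: SinfP. Qed.
Fact Sinf_mul1 : left_id Sinf_one Sinf_mul. Proof. by move=> s; exact: SinfP. Qed.
Fact Sinf_1mul : right_id Sinf_one Sinf_mul. Proof. by move=> s; exact: SinfP. Qed.
Fact Sinf_mulV : left_inverse Sinf_one Sinf_inv Sinf_mul.
Proof. by move=> s; apply: SinfP => i; exact: Sinf_inv_funK. Qed.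
Fact Sinf_Vmul : right_inverse Sinf_one Sinf_inv Sinf_mul.
Proof. by move=> s; apply: SinfP => i; exact: Sinf_funK. Qed.

HB.instance Definition _ := isGroup.Build Sinf
  Sinf_mulA Sinf_mul1 Sinf_1mul Sinf_mulV Sinf_Vmul.

End SinfGroup.

Section PermToSinf.
Variable n : nat.
Implicit Types s t : 'S_n.

Definition ext_perm s (i : nat) : nat :=
  if insub i is Some j then val (s j) else i.

Lemma ext_perm_ord s (i : 'I_n) : ext_perm s i = s i.
Proof. by rewrite /ext_perm valK. Qed.

Lemma ext_perm_out s i : n <= i -> ext_perm s i = i.
Proof. by move=> ni; rewrite /ext_perm insubF // ltnNge ni. Qed.

Lemma ext_permM s t i : ext_perm (s * t) i = ext_perm t (ext_perm s i).
Proof.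
have [lt_in|le_ni] := ltnP i n; last by rewrite !ext_perm_out.
by rewrite -[i]/(val (Ordinal lt_in)) !ext_perm_ord permM.
Qed.

Lemma ext_perm1 i : ext_perm 1 i = i.
Proof.
have [lt_in|le_ni] := ltnP i n; last by rewrite !ext_perm_out.
by rewrite -[i]/(val (Ordinal lt_in)) !ext_perm_ord perm1.
Qed.

Fact ext_perm_proof s : finsupp_perm (ext_perm s).
Proof.
apply/asboolP; split.
  by exists (ext_perm s^-1) => i; rewrite -ext_permM ?mulgV ?mulVg ext_perm1.
apply: sub_finite_set (finite_II n) => i /= si; rewrite ltnNge.
by apply/negP => /(ext_perm_out s).
Qed.

Definition Sinf_of s : Sinf := exist _ (ext_perm s) (ext_perm_proof s).

Fact Sinf_ofM : {morph Sinf_of : s t / s * t}.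
Proof. by move=> s t; apply: SinfP => i; exact: ext_permM. Qed.

HB.instance Definition _ := isMultiplicative.Build 'S_n Sinf Sinf_of Sinf_ofM.

Lemma Sinf_of_inj : injective Sinf_of.
Proof.
move=> s t st; apply/permP => i; apply: val_inj.
by rewrite /= -!ext_perm_ord -[ext_perm s]/(Sinf_fun (Sinf_of s)) st.
Qed.

End PermToSinf.

Section Braid.
Variable n : nat.

(* Artin's presentation: the generators [sigma_i] exchange the strands [i] and
   [i.+1] of ['I_n]. *)
Inductive braid_rel : word 'I_n.-1 -> word 'I_n.-1 -> Prop :=
| BraidRel (i j : 'I_n.-1) : j = i.+1 :> nat ->
    braid_rel [:: (i, true); (j, true); (i, true)]
              [:: (j, true); (i, true); (j, true)]
| BraidComm (i j : 'I_n.-1) : i.+1 < j ->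
    braid_rel [:: (i, true); (j, true)] [:: (j, true); (i, true)].

Definition braid : Type := pres_group braid_rel.

HB.instance Definition _ := Group.on braid.

Fact left_strand_proof (i : 'I_n.-1) : i < n.
Proof. exact: leq_trans (ltn_ord i) (leq_pred n). Qed.

Fact right_strand_proof (i : 'I_n.-1) : i.+1 < n.
Proof. by case: n i => [|m] [i]. Qed.

Definition adj_tperm (i : 'I_n.-1) : 'S_n :=
  tperm (Ordinal (left_strand_proof i)) (Ordinal (right_strand_proof i)).

Lemma val_adj_tperm (i : 'I_n.-1) (k : 'I_n) : adj_tperm i k =
  (if k == i :> nat then i.+1 else if k == i.+1 :> nat then i : nat else k) :> nat.
Proof.
rewrite /adj_tperm; case: tpermP => [->|->|/eqP ki /eqP kj] /=.
- by rewrite eqxx.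
- by rewrite eqxx gtn_eqF.
- by move: ki kj; rewrite -!val_eqE /= => /negPf-> /negPf->.
Qed.

Fact adj_tperm_rel u v :
  braid_rel u v -> eval_word adj_tperm u = eval_word adj_tperm v.
Proof.
case=> {u v} i j ij; apply/permP => k; apply: val_inj.
  rewrite /= /eval_letter /= !mulg1 !permM !val_adj_tperm ij.
  by do ![case: ifP] => *; lia.
rewrite /= /eval_letter /= !mulg1 !permM !val_adj_tperm.
by do ![case: ifP] => *; lia.
Qed.

Definition braid_perm : braid -> 'S_n := pres_hom adj_tperm_rel.

HB.instance Definition _ := isMultiplicative.Build braid 'S_n braid_perm
  (pres_homM adj_tperm_rel).

Definition pure_braid : subgroup braid := kernel braid_perm.

End Braid.

Section AddStrand.
Variable n : nat.

Definition add_strand_gen (i : 'I_n.-1) : braid n.+1 :=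
  pres_gen (@braid_rel n.+1) (Ordinal (left_strand_proof i)).

Fact add_strand_rel u v :
  braid_rel u v -> eval_word add_strand_gen u = eval_word add_strand_gen v.
Proof.
rewrite /add_strand_gen => uv; rewrite !eval_word_gen; apply/pres_piP/PresRel.
by case: uv => i j ij; [exact: BraidRel | exact: BraidComm].
Qed.

Definition add_strand : braid n -> braid n.+1 := pres_hom add_strand_rel.

HB.instance Definition _ := isMultiplicative.Build (braid n) (braid n.+1)
  add_strand (pres_homM add_strand_rel).

Lemma Sinf_of_adj_tperm (i : 'I_n.-1) :
  Sinf_of (adj_tperm (Ordinal (left_strand_proof i) : 'I_n.+1.-1)) =
  Sinf_of (adj_tperm i).
Proof.
apply: SinfP => k; rewrite /= /Sinf_fun /=.
have [kn|nk] := ltnP k n.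
  rewrite -[in RHS](erefl : val (Ordinal kn) = k) ext_perm_ord.
  rewrite -[in LHS](erefl : val (Ordinal (ltnW kn : k < n.+1)) = k) ext_perm_ord.
  by rewrite !val_adj_tperm.
rewrite [in RHS]ext_perm_out //; have [kn|kn] := ltnP k n.+1; last first.
  exact: ext_perm_out.
rewrite -[in LHS](erefl : val (Ordinal kn) = k) ext_perm_ord val_adj_tperm /=.
have := right_strand_proof i; have := left_strand_proof i.
by do ![case: ifP] => *; lia.
Qed.

Lemma add_strand_perm (x : braid n) :
  Sinf_of (braid_perm (add_strand x)) = Sinf_of (braid_perm x).
Proof.
rewrite -(pres_reprK x); move: (repr x) => w.
have -> : add_strand (pres_pi _ w) = eval_word add_strand_gen w.
  exact: pres_hom_pi.
have -> : braid_perm (pres_pi _ w) = eval_word (@adj_tperm n) w.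
  exact: pres_hom_pi.
rewrite (mult_eval_word (@braid_perm n.+1)).
rewrite (mult_eval_word (@Sinf_of n.+1)) (mult_eval_word (@Sinf_of n)).
apply: eq_eval_word => i; apply: etrans (Sinf_of_adj_tperm i).
congr Sinf_of; exact: pres_hom_gen.
Qed.

End AddStrand.

Definition Binf : Type := dlim (fun n => @add_strand n).

HB.instance Definition _ := Group.on Binf.

Definition Binf_in n (x : braid n) : Binf := dlim_in (fun n => @add_strand n) x.

HB.instance Definition _ n :=
  isMultiplicative.Build (braid n) Binf (@Binf_in n)
    (@dlim_inM _ (fun n => @add_strand n) n).

(* [ord_max : 'I_i.+1] is the last generator of the braid group on [i.+2] strands,
   so [sigma i] exchanges the strands [i] and [i.+1]. *)
Definition sigma (i : nat) : Binf :=
  Binf_in (pres_gen (@braid_rel i.+2) ord_max).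

Definition braid_Sinf n : braid n -> Sinf := @Sinf_of n \o @braid_perm n.

Fact braid_SinfM n : {morph @braid_Sinf n : x y / x * y}.
Proof. by move=> x y; rewrite /braid_Sinf /= !gmulfM. Qed.

HB.instance Definition _ n :=
  isMultiplicative.Build (braid n) Sinf (@braid_Sinf n) (@braid_SinfM n).

Definition Binf_perm : Binf -> Sinf :=
  @dlim_hom _ (fun n => @add_strand n) Sinf (fun n => @braid_Sinf n)
    add_strand_perm.

HB.instance Definition _ := isMultiplicative.Build Binf Sinf Binf_perm
  (@dlim_homM _ (fun n => @add_strand n) Sinf (fun n => @braid_Sinf n)
     add_strand_perm).

(* The union in [Binf] of the images of the pure braid groups. *)
Definition Pinf_pred : {pred Binf} :=
  fun u => `[< exists n, exists2 x : braid n, x \in pure_braid n & u = Binf_in x >].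

Lemma Pinf_predE u : (u \in Pinf_pred) = (u \in kernel Binf_perm).
Proof.
have in_hom n (x : braid n) : Binf_perm (Binf_in x) = Sinf_of (braid_perm x).
  exact: dlim_hom_in.
have inK v : (v \in kernel Binf_perm) = (Binf_perm v == 1) by [].
apply/asboolP/idP => [[n [x /eqP px ->]]|].
  by rewrite inK in_hom px; apply/eqP; exact: mult1.
have [n _ [x ->]] := dlimP u 0; rewrite inK (in_hom n x) => /eqP px.
exists n, x => //; apply/eqP/Sinf_of_inj; rewrite px; apply: esym; exact: mult1.
Qed.

Fact Pinf_closed : group_closed Pinf_pred.
Proof.
have [k1 kF] := kernel_closed Binf_perm.
by split => [|x y]; rewrite !Pinf_predE //; exact: kF.
Qed.

Fact Pinf_normal (u v : Binf) :
  u \in Subgroup Pinf_closed -> u ^ v \in Subgroup Pinf_closed.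
Proof. by rewrite !Pinf_predE; exact: kernel_normal. Qed.

Definition Pinf : normal_subgroup Binf := NormalSubgroup Pinf_normal.

Definition BinfQ : Type := quot_group (derived Pinf).

HB.instance Definition _ := Group.on BinfQ.

Definition BinfQ_pi : Binf -> BinfQ := quot_pi (derived Pinf).

HB.instance Definition _ :=
  isMultiplicative.Build Binf BinfQ BinfQ_pi (@quot_piM _ (derived Pinf)).

(* The quotient of [Pinf] by its derived subgroup, as a subgroup of [BinfQ]. *)
Definition Pinf_ab : subgroup BinfQ := image_subgroup BinfQ_pi Pinf.

Fact Binf_perm_derived x : x \in derived Pinf -> Binf_perm x = 1.
Proof.
move=> /asboolP/(_ (kernel Binf_perm)) kx; apply/eqP; apply: kx.
move=> _ [a Pa] [b Pb <-] /=.
have ka : a \in kernel Binf_perm by rewrite -Pinf_predE.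
rewrite commgEl; apply: (@subMg _ (kernel Binf_perm)).
  exact: (@subVg _ (kernel Binf_perm)).
exact: kernel_normal.
Qed.

Definition p_map : BinfQ -> Sinf := quot_hom Binf_perm_derived.

HB.instance Definition _ :=
  isMultiplicative.Build BinfQ Sinf p_map (quot_homM Binf_perm_derived).

Definition P2 : Type := {A : {fset nat} | #|` A| == 2}.

HB.instance Definition _ := SubChoice.on P2.

Fact P2_act_proof (s : Sinf) (A : P2) : #|` [fset s i | i in val A]%fset| == 2.
Proof. by rewrite card_imfset ?(valP A) //; exact: Sinf_inj. Qed.

Definition P2_act (s : Sinf) (A : P2) : P2 :=
  exist _ [fset s i | i in val A]%fset (P2_act_proof s A).

Fact P2_pair_proof (i : nat) : #|` [fset i; i.+1]%fset| == 2.
Proof. by rewrite cardfs2 neq_ltn ltnSn. Qed.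

Definition P2_adj (i : nat) : P2 := exist _ [fset i; i.+1]%fset (P2_pair_proof i).

Definition P2_orbit (G : set Sinf) (A : P2) : set P2 := [set P2_act s A | s in G].

Definition P2_orbits (G : set Sinf) : Type :=
  {O : set P2 | `[< exists A, O = P2_orbit G A >]}.

HB.instance Definition _ G := SubChoice.on (P2_orbits G).

Definition free_basis (K : choiceType) (k : K) : {freeg K} :=
  [freeg [:: (1%R, k)]].

(* Isomorphisms from a group written multiplicatively to one written additively. *)

Definition iso_add (G : groupType) (A : zmodType) (f : G -> A) : Prop :=
  bijective f /\ {morph f : x y / (x * y)%g >-> (x + y)%R}.

Definition finite_subgroup (G : groupType) (S : subgroup G) : Prop :=
  finite_set [set` S].

Definition subgroup_order (G : groupType) (S : subgroup G) : nat :=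
  #|` fset_set [set` S]|.

(* Main.v *)
Require Import Defs.
From HB Require Import structures.
From mathcomp Require Import all_boot all_order all_algebra.
From mathcomp Require Import fingroup perm generic_quotient finmap.
From mathcomp Require Import boolp classical_sets functions cardinality.
From mathcomp Require Import zify.
From mathcomp.multinomials Require Import freeg.

(** Counting signed crossings of pairs of strands maps the braid group to the
    semidirect product of [Z^P2] by [Sinf]: [sigma i] goes to the indicator of
    [{i, i+1}] over the transposition of [i] and [i+1]. This map is injective on
    [BinfQ]. Indeed, by the Coxeter presentation of the symmetric groups, pure
    braids are products of conjugates of [sigma 0 ^+ 2]; modulo commutators of
    pure braids such a conjugate only depends on the pair of strands it links,
    since the stabiliser of [{0, 1}] is generated by transpositions whose lifts
    commute with [sigma 0 ^+ 2]; and these classes are sent to twice the basis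
    vectors of [Z[P2]]. The image consists of the [(a, s)] with [a] of finite
    support and [a {i, j}] odd exactly when [s] inverts the order of [i] and [j].

    Everything else is read off this model. Pure classes are torsion-free, and an
    involution [(a, s)] with [s] exchanging [i] and [j] would have [a {i, j} = 0],
    which is even. If [G] has odd order then no element of [G] exchanges two
    points, so there is a [G]-invariant tournament on the points; the function [w]
    recording where it disagrees with the usual order makes [g |-> (w o g - w, g)]
    a section. Two sections differ by a cocycle with values in the permutation
    module [Z[P2]], whose first cohomology vanishes. Finally a pure class
    normalizes a finite subgroup if and only if it centralises it, that is, if and
    only if its linking numbers are constant on orbits. *)

Set Implicit Arguments.
Unset Strict Implicit.
Unset Printing Implicit Defensive.

Import GRing.Theory.

Local Open Scope classical_set_scope.
Local Open Scope group_scope.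

(** * Powers, conjugates and commutators under homomorphisms *)

Section MultiplicativeTheory.
Variables (G H : groupType) (f : {multiplicative G -> H}).

Lemma multX x n : f (x ^+ n) = f x ^+ n.
Proof. by elim: n => [|n IHn]; rewrite ?mult1 // !expgS gmulfM IHn. Qed.

Lemma multJ x y : f (x ^ y) = f x ^ f y.
Proof. by rewrite !conjgE !gmulfM multV. Qed.

Lemma multR x y : f [~ x, y] = [~ f x, f y].
Proof. by rewrite !commgEl gmulfM multV multJ. Qed.

End MultiplicativeTheory.

(** * Finite subgroups *)

(** All orbits of [f] in [F] have two elements; the induction removes one orbit at a time. *)
Lemma card_fixfree_involution (K : choiceType) (F : {fset K}) (f : K -> K) :
    (forall x, x \in F -> [/\ f x \in F, f (f x) = x & f x != x]) ->
  ~~ odd #|` F|.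
Proof.
have [n] := ubnP #|` F|; elim: n F => // n IHn F ltFn Ff.
have [->|[x Fx]] := fset_0Vmem F; first by rewrite cardfs0.
have [Ffx ffx fxx] := Ff x Fx.
have cF : #|` F| = #|` F `\ x `\ f x|%fset.+2.
  by rewrite (cardfsD1 x) Fx (cardfsD1 (f x)) !inE fxx Ffx.
rewrite cF /= negbK; apply: IHn => [|y]; first by move: ltFn; rewrite cF; lia.
rewrite !inE => /and3P[yfx yx Fy]; have [Ffy ffy fyy] := Ff y Fy.
split => //; rewrite Ffy andbT; apply/andP; split.
  by apply: contra_neq yx => e; rewrite -ffy e ffx.
by apply: contra_neq yfx => e; rewrite -ffy e.
Qed.

Section FiniteSubgroup.
Variables (G : groupType) (S : subgroup G).
Hypothesis finS : finite_subgroup S.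

Lemma subXg x n : x \in S -> x ^+ n \in S.
Proof.
by move=> Sx; elim: n => [|n IHn]; rewrite ?expgS ?subMg // sub1g.
Qed.

Lemma mem_fset_subgroup x : (x \in fset_set [set` S]) = (x \in S).
Proof. by rewrite in_fset_set // mem_setE. Qed.

(** Otherwise the powers of [x] would be pairwise distinct and embed [nat] in the finite set [S]. *)
Lemma finite_subgroup_torsion x : x \in S -> exists2 m, 0 < m & x ^+ m = 1.
Proof.
move=> Sx; apply: contrapT => no_m; apply: infinite_nat.
have -> : [set: nat] = (fun m => x ^+ m) @^-1` [set` S].
  by apply/seteqP; split => // m _; exact: subXg.
apply: finite_preimage finS => m1 m2 _ _ /=.
wlog le_m : m1 m2 / m1 <= m2 => [W e|].
  by have [/W->|/ltnW/W->] := leqP m1 m2.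
move=> /esym e; apply/eqP; rewrite eqn_leq le_m /=; apply: contra_notT no_m.
rewrite -ltnNge => lt_m; exists (m2 - m1)%N; first by rewrite subn_gt0.
by rewrite expgnFr // e mulgV.
Qed.

(** Left translation by an element of order two is a fixed-point-free involution of [S]. *)
Lemma odd_no_involution x :
  odd (subgroup_order S) -> x \in S -> x ^+ 2 = 1 -> x = 1.
Proof.
move=> oddS Sx x2; apply: contraTeq oddS => x1.
apply: (@card_fixfree_involution _ _ (fun y => x * y)) => y.
rewrite !mem_fset_subgroup => Sy; split; first exact: subMg.
  by rewrite mulgA -expg2 x2 mul1g.
by apply: contra_neq x1 => e; apply: (mulIg y); rewrite e mul1g.
Qed.

(** Inversion is a fixed-point-free involution of [S] minus [1]. *)
Lemma no_involution_odd :
  (forall x, x \in S -> x ^+ 2 = 1 -> x = 1) -> odd (subgroup_order S).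
Proof.
move=> invS; rewrite /subgroup_order (cardfsD1 1) mem_fset_subgroup sub1g /=.
apply: (@card_fixfree_involution _ _ (fun y => y^-1)) => y.
rewrite !inE !mem_fset_subgroup => /andP[y1 Sy].
split; rewrite ?invgK ?invg_eq1 ?y1 ?subVg //; apply: contra_neq y1 => e.
by apply: invS => //; rewrite expg2 -{1}e mulVg.
Qed.

(** An even exponent can be halved, since [x ^+ m./2] then squares to [1]. *)
Lemma odd_order_exponent x : odd (subgroup_order S) -> x \in S ->
  exists2 m, odd m & x ^+ m = 1.
Proof.
move=> oddS Sx; have [m m_gt0 xm] := finite_subgroup_torsion Sx.
elim/ltn_ind: m m_gt0 xm => m IHm m_gt0 xm.
have [oddm|evenm] := boolP (odd m); first by exists m.
have em : m = (m./2 * 2)%N by move: evenm; lia.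
apply: (IHm m./2); [lia | lia |].
apply: odd_no_involution => //; first exact: subXg.
by rewrite -expgnA -em.
Qed.

End FiniteSubgroup.

(** * Adjacent transpositions *)

Lemma SinfM (s t : Sinf) i : Sinf_fun (s * t) i = t (s i). Proof. by []. Qed.

Lemma SinfK (s : Sinf) : cancel s (Sinf_fun s^-1). Proof. exact: Sinf_funK. Qed.

Lemma SinfVK (s : Sinf) : cancel (Sinf_fun s^-1) s. Proof. exact: Sinf_inv_funK. Qed.

Lemma finite_nat_bound (A : set nat) :
  finite_set A -> exists n, forall m, A m -> m < n.
Proof.
move=> /finite_seqP[r ->]; exists (\max_(i <- r) i).+1 => m /= rm.
by rewrite ltnS; apply: (@leq_bigmax_seq _ r xpredT id).
Qed.

Lemma Sinf_bound (s : Sinf) : exists n, forall m, n <= m -> s m = m.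
Proof.
have [n sn] := finite_nat_bound (Sinf_fin s); exists n => m nm.
by apply/eqP; apply: contraTT nm => /eqP/sn; rewrite -ltnNge.
Qed.

Definition adjn (i k : nat) :=
  if k == i then i.+1 else if k == i.+1 then i else k.

Lemma adjnK i : involutive (adjn i).
Proof. by move=> k; rewrite /adjn; do ![case: ifP]; lia. Qed.

Section Descents.
Variables (G : groupType) (t : nat -> G).

(** The product of [t (k + d - 1)] down to [t k], a lift of the cycle that carries [k + d] to [k].
    Under the Coxeter relations, those with [k + d = n.+1] represent the cosets of the group
    generated by the [t i] with [i < n] in the one generated by the [t i] with [i <= n]. *)
Fixpoint descent k d : G := if d is d'.+1 then t (k + d') * descent k d' else 1.

Lemma descentSr k d : descent k d.+1 = descent k.+1 d * t k.
Proof.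
elim: d => [|d IHd]; first by rewrite /= addn0 mul1g mulg1.
by rewrite -[LHS]/(t (k + d.+1) * descent k d.+1) IHd mulgA -addSnnS.
Qed.

Section Permutations.
Variable pi : {multiplicative G -> Sinf}.
Hypothesis pi_t : forall i k, Sinf_fun (pi (t i)) k = adjn i k.

Lemma descent_top k d : Sinf_fun (pi (descent k d)) (k + d) = k.
Proof.
elim: d => [|d IHd]; first by rewrite mult1 addn0.
by rewrite /= gmulfM SinfM pi_t /adjn addnS eqxx gtn_eqF ?ltnSn ?IHd.
Qed.

Lemma descent_fix k d m : k + d < m -> Sinf_fun (pi (descent k d)) m = m.
Proof.
elim: d => [|d IHd] ltm; first by rewrite mult1.
by rewrite /= gmulfM SinfM pi_t /adjn !gtn_eqF ?IHd //; lia.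
Qed.

Lemma Sinf_top_le (s : Sinf) n : (forall m, n < m -> s m = m) -> s n <= n.
Proof.
move=> sn; rewrite leqNgt; apply/negP => lt_n; have /Sinf_inj := sn _ lt_n.
by move=> e; rewrite e ltnn in lt_n.
Qed.

(** The descent carries [n] to [s n] and fixes the points above [n], so dividing by it lowers the
    bound on the support by one. This is the induction step of the next two results. *)
Lemma descent_fix_top (s : Sinf) n : (forall m, n < m -> s m = m) ->
  forall m, n <= m -> Sinf_fun (s * (pi (descent (s n) (n - s n)))^-1) m = m.
Proof.
move=> sn m; have le_sn := Sinf_top_le sn; set c : Sinf := pi _.
have ctop : c n = s n by have := descent_top (s n) (n - s n); rewrite subnKC.
rewrite leq_eqVlt => /predU1P[<-|ltm]; first by rewrite SinfM -ctop SinfK.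
rewrite SinfM sn // -{1}(_ : c m = m) ?SinfK //.
by apply: descent_fix; rewrite subnKC.
Qed.

Lemma adjacent_generate (s : Sinf) : exists x, pi x = s.
Proof.
have [n] := Sinf_bound s; elim: n s => [|n IHn] s sn.
  by exists 1; rewrite mult1; apply: SinfP => m; rewrite sn.
have [x xE] := IHn _ (descent_fix_top sn).
exists (x * descent (s n) (n - s n)).
by rewrite gmulfM xE mulgVK.
Qed.

(* Dividing by a descent that avoids [t 0] and [t 1], hence commutes with [z],
   shrinks the support of [pi y] until it lies in [{0, 1}]. *)
Lemma stabiliser_commute (z : G) :
    commute z (t 0) -> (forall j, 1 < j -> commute z (t j)) ->
    (forall y, pi y = 1 -> commute z y) ->
  forall y, Sinf_fun (pi y) 0 < 2 -> Sinf_fun (pi y) 1 < 2 -> commute z y.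
Proof.
move=> z0 zt zker y; have [n] := Sinf_bound (pi y).
have [n' le_n'] : exists n', n <= n'.+2 by exists n; lia.
move=> sn; have {n le_n'}sn m : n'.+2 <= m -> Sinf_fun (pi y) m = m.
  by move=> le_m; apply: sn; exact: leq_trans le_m.
have zdesc k d : 1 < k -> commute z (descent k d).
  move=> k1; elim: d => [|d IHd]; first exact: commute1.
  by apply: commuteM => //; apply: zt; lia.
elim: n' y sn => [|n IHn] y sn y0 y1.
  have y01 : Sinf_fun (pi y) 0 <> Sinf_fun (pi y) 1 by move=> /Sinf_inj.
  (* On [{0, 1}] the permutation is trivial or the transposition; in the second case dividing by
     [t 0] leads back to the kernel of [pi]. *)
  have [e0|e0] := eqVneq (Sinf_fun (pi y) 0) 0%N.
    apply: zker; apply: SinfP => -[|[|m]] //; last exact: sn.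
    by change (Sinf_fun (pi y) 1 = 1%N); lia.
  rewrite -(mulgVK (t 0) y); apply: commuteM => //; apply: zker.
  rewrite gmulfM multV; apply/eqP; rewrite divg_eq mul1g; apply/eqP.
  apply: SinfP => -[|[|m]]; rewrite pi_t /adjn /=; try lia; exact: sn.
have {}sn m : n.+2 < m -> Sinf_fun (pi y) m = m by apply: sn.
(* Since [pi y] preserves [{0, 1}], the top point goes to some [k > 1], and the descent to [k] only
   involves [t j] with [j > 1]. *)
have top_gt1 : 1 < Sinf_fun (pi y) n.+2.
  have i0 : Sinf_fun (pi y) 0 <> Sinf_fun (pi y) n.+2 by move=> /Sinf_inj.
  have i1 : Sinf_fun (pi y) 1 <> Sinf_fun (pi y) n.+2 by move=> /Sinf_inj.
  have i2 : Sinf_fun (pi y) 0 <> Sinf_fun (pi y) 1 by move=> /Sinf_inj.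
  lia.
set d := descent (Sinf_fun (pi y) n.+2) (n.+2 - Sinf_fun (pi y) n.+2).
have dfix m : m < 2 -> Sinf_fun (pi d) m = m.
  move=> m2; rewrite /d; elim: (_ - _)%N => [|e IHe]; first by rewrite mult1.
  by rewrite /= gmulfM SinfM pi_t /adjn !ltn_eqF ?IHe //; lia.
have dVfix m : m < 2 -> Sinf_fun (pi d)^-1 m = m.
  by move=> m2; rewrite -{1}(dfix m) ?SinfK.
rewrite -(mulgVK d y); apply: commuteM; last exact: zdesc.
apply: IHn => [m le_m||]; rewrite gmulfM multV.
- exact: descent_fix_top.
- by rewrite SinfM dVfix.
- by rewrite SinfM dVfix.
Qed.

End Permutations.

(** * The Coxeter presentation of the symmetric groups *)

Section Coxeter.
Hypothesis t_sq : forall i, t i * t i = 1.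
Hypothesis t_braid : forall i, t i * t i.+1 * t i = t i.+1 * t i * t i.+1.
Hypothesis t_comm : forall i j, i.+1 < j -> commute (t i) (t j).

Lemma descent_comm_above k d j : k + d < j -> commute (t j) (descent k d).
Proof.
elim: d => [|d IHd] ltj; first exact: commute1.
by apply: commuteM; [apply/commute_sym/t_comm | apply: IHd]; lia.
Qed.

Lemma descent_comm_below k d j : j.+1 < k -> commute (t j) (descent k d).
Proof.
move=> ltj; elim: d => [|d IHd]; first exact: commute1.
by apply: commuteM => //; apply: t_comm; lia.
Qed.

(** Moving left, [t j.+1] commutes with the factors below [t j]; the braid relation turns it into
    [t j], which commutes with the factors above [t j.+1]. *)
Lemma descent_conj k d j : k <= j -> j.+1 < k + d ->
  descent k d * t j.+1 = t j * descent k d.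
Proof.
elim: d => [|d IHd] le_kj lt_j; first lia.
have [lt_jd|le_dj] := ltnP j.+1 (k + d).
  by rewrite /= -mulgA IHd // !mulgA (t_comm lt_jd).
have ej : j.+1 = (k + d)%N by lia.
case: d ej {IHd lt_j le_dj} => [|d] ej; first lia.
have {}ej : j = (k + d)%N by lia.
rewrite /= addnS -ej -!mulgA -(descent_comm_above (k := k) (d := d)) ?ej //.
by rewrite !mulgA t_braid.
Qed.

(** Append the letters of [w] one by one. A letter [j] to the right of the descent passes through it
    unchanged if [j.+1 < k], lengthens it if [j.+1 = k], cancels its last factor if [j = k], and
    comes out on the left as [j.-1] if [k < j]. *)
Lemma coset_descent n (w : seq nat) : all (fun i => i <= n) w ->
  exists w' k d, [/\ all (fun i => i < n) w', (k + d = n.+1)%N &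
    \prod_(i <- w) t i = (\prod_(i <- w') t i) * descent k d].
Proof.
elim/last_ind: w => [|w j IHw].
  by exists [::], n.+1, 0%N; rewrite !big_nil addn0 mulg1.
rewrite all_rcons => /andP[le_jn /IHw[w' [k [d [w'n kd e]]]]].
rewrite big_rcons /= e; have [ltj|] := ltnP j.+1 k.
  exists (rcons w' j), k, d; split => //; first by rewrite all_rcons w'n andbT; lia.
  by rewrite big_rcons /= -!mulgA (descent_comm_below d ltj).
rewrite leq_eqVlt => /predU1P[ek|lt_kj].
  by exists w', j, d.+1; rewrite descentSr -ek mulgA; split => //; lia.
have [lt_kj'|le_jk] := ltnP k j.
  case: j le_jn {lt_kj} lt_kj' => // j le_jn lt_kj.
  exists (rcons w' j), k, d; split => //; first by rewrite all_rcons w'n andbT.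
  by rewrite big_rcons /= -!mulgA descent_conj //; lia.
have ej : j = k by lia.
case: d kd e => [|d] kd e; first lia.
exists w', k.+1, d; split; [by []|lia|].
by rewrite ej descentSr -!mulgA t_sq mulg1.
Qed.

Variable pi : {multiplicative G -> Sinf}.
Hypothesis pi_t : forall i k, Sinf_fun (pi (t i)) k = adjn i k.

Lemma prod_adjacent_fix (w : seq nat) n m :
  all (fun i => i < n) w -> n < m -> Sinf_fun (pi (\prod_(i <- w) t i)) m = m.
Proof.
move=> wn nm; elim: w wn => [|i w IHw] /=; first by rewrite big_nil mult1.
move=> /andP[lt_i wn]; rewrite big_cons gmulfM SinfM pi_t /adjn.
by rewrite !gtn_eqF ?IHw //; lia.
Qed.

(** Induction on a bound for the letters: in the coset form the point [n.+1] goes to [k], so a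
    trivial permutation forces the descent to be empty. *)
Theorem coxeter_presentation (w : seq nat) :
  pi (\prod_(i <- w) t i) = 1 -> \prod_(i <- w) t i = 1.
Proof.
have [n wn] : exists n, all (fun i => i < n) w.
  exists (\max_(i <- w) i).+1; apply/allP => i wi; rewrite ltnS.
  exact: (@leq_bigmax_seq _ w xpredT id).
elim: n w wn => [|n IHn] w; first by case: w => //; rewrite big_nil.
move=> /coset_descent[w' [k [d [w'n kd ->]]]] pi1.
have : Sinf_fun (pi (\prod_(i <- w') t i * descent k d)) n.+1 = k.
  by rewrite gmulfM SinfM (prod_adjacent_fix w'n) // -kd descent_top.
rewrite pi1 => /= ek; have {}ek : n.+1 = k := ek.
by move: pi1; rewrite (_ : d = 0%N) ?mulg1; [exact: IHn | lia].
Qed.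

End Coxeter.
End Descents.

(** * Pairs of points *)

(* The junk value when [i = j] is [{0, 1}]. *)
Definition P2_mk (i j : nat) : P2 := insubd (P2_adj 0) [fset i; j]%fset.

Lemma val_P2_mk i j : i != j -> val (P2_mk i j) = [fset i; j]%fset.
Proof. by move=> ij; rewrite val_insubd cardfs2 ij. Qed.

Lemma P2_mkC i j : P2_mk i j = P2_mk j i.
Proof. by rewrite /P2_mk fsetUC. Qed.

Lemma P2_adjE i : P2_adj i = P2_mk i i.+1.
Proof. by apply: val_inj; rewrite val_P2_mk // ltn_eqF. Qed.

Lemma P2_mkP (A : P2) : exists i j, i < j /\ A = P2_mk i j.
Proof.
have cA := valP A; have [e|[i Ai]] := fset_0Vmem (val A).
  by move: cA; rewrite e cardfs0.
move: cA; rewrite (cardfsD1 i) Ai => /cardfs1P[j e].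
have ij : i != j.
  by have := fset11 j; rewrite -e !inE eq_sym => /andP[].
have {e}eA : A = P2_mk i j by apply: val_inj; rewrite val_P2_mk // -e fsetD1K.
have [lt_ij|lt_ji|e] := ltngtP i j; last by rewrite e eqxx in ij.
  by exists i, j.
by exists j, i; rewrite P2_mkC.
Qed.

Lemma P2_mk_eq i j k l : i != j -> k != l ->
  (P2_mk i j == P2_mk k l) = (i == k) && (j == l) || (i == l) && (j == k).
Proof.
move=> ij kl; rewrite -val_eqE /= !val_P2_mk //; apply/eqP/idP.
  move=> /fsetP e.
  have := e i; have := e j; have := e k; have := e l; rewrite !inE !eqxx /=.
  by rewrite ?orbT; lia.
by move=> /orP[]/andP[/eqP-> /eqP->] //; rewrite fsetUC.
Qed.

Lemma P2_act_mk s i j : i != j -> P2_act s (P2_mk i j) = P2_mk (s i) (s j).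
Proof.
move=> ij; apply: val_inj; rewrite /= !val_P2_mk ?(inj_eq (@Sinf_inj s)) //.
by rewrite imfset_fset2.
Qed.

Lemma P2_act1 A : P2_act 1 A = A.
Proof. by apply: val_inj; rewrite /= imfset_id. Qed.

Lemma P2_actM s t A : P2_act (s * t) A = P2_act t (P2_act s A).
Proof.
have [i [j [ij ->]]] := P2_mkP A.
by rewrite !P2_act_mk ?(inj_eq (@Sinf_inj s)) ?ltn_eqF.
Qed.

Lemma P2_actK s : cancel (P2_act s) (P2_act s^-1).
Proof. by move=> A; rewrite -P2_actM mulgV P2_act1. Qed.

Lemma P2_actVK s : cancel (P2_act s^-1) (P2_act s).
Proof. by move=> A; rewrite -P2_actM mulVg P2_act1. Qed.

Lemma P2_act_inj s : injective (P2_act s).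
Proof. exact: can_inj (P2_actK s). Qed.

(** * The linking group *)

(* The semidirect product of [Z^P2] by [Sinf]. The generator [sigma i] is sent to
   the indicator of [{i, i+1}] over the transposition of [i] and [i+1], so the
   first component of the image of a pure braid counts each linking number twice. *)
Definition linking : Type := ((P2 -> int) * Sinf)%type.

HB.instance Definition _ := Choice.on linking.

Section LinkingGroup.
Implicit Types x y z : linking.

Definition lk_one : linking := (fun=> 0%R, 1).
(** Products are read from left to right: [x] moves the pair [A] before [y] counts its crossings. *)
Definition lk_mul x y : linking :=
  (fun A => (x.1 A + y.1 (P2_act x.2 A))%R, x.2 * y.2).
Definition lk_inv x : linking := (fun A => (- x.1 (P2_act (x.2^-1)%g A))%R, x.2^-1).

Lemma linkingP x y : x.1 =1 y.1 -> x.2 = y.2 -> x = y.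
Proof. by case: x y => [a s] [b t] /= /funext-> ->. Qed.

Fact lk_mulA : associative lk_mul.
Proof.
by move=> x y z; apply: linkingP => [A|] /=; rewrite ?P2_actM ?addrA ?mulgA.
Qed.
Fact lk_mul1 : left_id lk_one lk_mul.
Proof. by move=> x; apply: linkingP => [A|] /=; rewrite ?P2_act1 ?add0r ?mul1g. Qed.
Fact lk_1mul : right_id lk_one lk_mul.
Proof. by move=> x; apply: linkingP => [A|] /=; rewrite ?addr0 ?mulg1. Qed.
Fact lk_mulV : left_inverse lk_one lk_inv lk_mul.
Proof. by move=> x; apply: linkingP => [A|] /=; rewrite ?addNr ?mulVg. Qed.
Fact lk_Vmul : right_inverse lk_one lk_inv lk_mul.
Proof. by move=> x; apply: linkingP => [A|] /=; rewrite ?P2_actK ?subrr ?mulgV. Qed.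

HB.instance Definition _ := isGroup.Build linking
  lk_mulA lk_mul1 lk_1mul lk_mulV lk_Vmul.

Definition lk_num (x : linking) : P2 -> int := x.1.
Definition lk_perm (x : linking) : Sinf := x.2.

Fact lk_permM : {morph lk_perm : x y / x * y}. Proof. by []. Qed.
HB.instance Definition _ := isMultiplicative.Build linking Sinf lk_perm lk_permM.

Lemma lk_num1 A : lk_num 1 A = 0%R. Proof. by []. Qed.

Lemma lk_numM x y A :
  lk_num (x * y) A = (lk_num x A + lk_num y (P2_act (lk_perm x) A))%R.
Proof. by []. Qed.

Lemma lk_numV x A : lk_num x^-1 A = (- lk_num x (P2_act ((lk_perm x)^-1)%g A))%R.
Proof. by []. Qed.

Lemma lkP x y : lk_num x =1 lk_num y -> lk_perm x = lk_perm y -> x = y.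
Proof. exact: linkingP. Qed.

Lemma lk_pure_comm x y : lk_perm x = 1 -> lk_perm y = 1 -> commute x y.
Proof.
move=> x1 y1; apply: lkP => [A|]; last by rewrite !lk_permM x1 y1.
by rewrite !lk_numM x1 y1 !P2_act1 addrC.
Qed.

End LinkingGroup.

(** * The linking numbers of a braid *)

Lemma Sinf_of_adj_tpermE n (i : 'I_n.-1) k :
  Sinf_fun (Sinf_of (adj_tperm i)) k = adjn i k.
Proof.
rewrite /Sinf_fun /=; have [kn|nk] := ltnP k n.
  by rewrite -[k]/(val (Ordinal kn)) ext_perm_ord val_adj_tperm.
by rewrite ext_perm_out // /adjn; have := right_strand_proof i; do ![case: eqP]; lia.
Qed.

Definition adj_Sinf (i : nat) : Sinf := Sinf_of (@adj_tperm i.+2 ord_max).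

Lemma adj_SinfE i k : adj_Sinf i k = adjn i k.
Proof. exact: Sinf_of_adj_tpermE. Qed.

Definition lk_gen (i : nat) : linking := (fun A => (A == P2_adj i)%:R%R, adj_Sinf i).

Lemma lk_num_gen i A : lk_num (lk_gen i) A = (A == P2_adj i)%:R%R.
Proof. by []. Qed.

Lemma lk_perm_gen i : lk_perm (lk_gen i) = adj_Sinf i.
Proof. by []. Qed.

Lemma P2_act_adj i a b : a != b ->
  P2_act (adj_Sinf i) (P2_mk a b) = P2_mk (adjn i a) (adjn i b).
Proof. by move=> ab; rewrite P2_act_mk // !adj_SinfE. Qed.

Lemma P2_act_adjK i : involutive (P2_act (adj_Sinf i)).
Proof.
move=> A; rewrite -P2_actM -[RHS]P2_act1; congr P2_act; apply: SinfP => k.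
by rewrite SinfM !adj_SinfE adjnK.
Qed.

Lemma P2_act_adj_eq i A B :
  (P2_act (adj_Sinf i) A == B) = (A == P2_act (adj_Sinf i) B).
Proof. by rewrite -(inj_eq (@P2_act_inj (adj_Sinf i))) P2_act_adjK. Qed.

(** In either word of the braid relation each pair among the three strands crosses exactly once.
    Distant generators fix each other's pair. *)
Fact lk_gen_rel n (u v : word 'I_n.-1) : braid_rel u v ->
  eval_word (fun i : 'I_n.-1 => lk_gen i) u =
  eval_word (fun i : 'I_n.-1 => lk_gen i) v.
Proof.
case=> {u v} i j ij; rewrite /= /eval_letter /= !mulg1; apply: lkP; last first.
- apply: SinfP => k; rewrite !lk_permM !SinfM !adj_SinfE /adjn.
  by do ![case: ifP]; lia.
- have ei : P2_act (adj_Sinf i) (P2_adj j) = P2_adj j.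
    by rewrite P2_adjE P2_act_adj ?ltn_eqF // /adjn !gtn_eqF //; lia.
  have ej : P2_act (adj_Sinf j) (P2_adj i) = P2_adj i.
    by rewrite P2_adjE P2_act_adj ?ltn_eqF // /adjn !ltn_eqF //; lia.
  move=> A; rewrite !(lk_numM, lk_num_gen, lk_perm_gen) !P2_act_adj_eq ei ej.
  exact: addrC.
- apply: SinfP => k; rewrite !lk_permM !SinfM !adj_SinfE ij /adjn.
  by do ![case: ifP]; lia.
- have ei : P2_act (adj_Sinf i) (P2_adj j) = P2_mk i j.+1.
    rewrite P2_adjE P2_act_adj ?ltn_eqF //.
    by congr P2_mk; rewrite ij /adjn; do ![case: ifP]; lia.
  have ej : P2_act (adj_Sinf j) (P2_adj i) = P2_mk i j.+1.
    rewrite P2_adjE P2_act_adj ?ltn_eqF //.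
    by congr P2_mk; rewrite ij /adjn; do ![case: ifP]; lia.
  move=> A; rewrite !(lk_numM, lk_num_gen, lk_perm_gen) !P2_act_adj_eq ei ej.
  rewrite -(canRL (P2_act_adjK _) ei) -(canRL (P2_act_adjK _) ej).
  by rewrite addrCA [RHS]addrCA; congr (_ + _)%R; exact: addrC.
Qed.

Definition braid_lk n : braid n -> linking := pres_hom (@lk_gen_rel n).

HB.instance Definition _ n := isMultiplicative.Build (braid n) linking (@braid_lk n)
  (pres_homM (@lk_gen_rel n)).

Lemma add_strand_lk n (x : braid n) : braid_lk (add_strand x) = braid_lk x.
Proof.
rewrite -(pres_reprK x); move: (repr x) => w.
have -> : add_strand (pres_pi _ w) = eval_word (@add_strand_gen n) w.
  exact: pres_hom_pi.
have -> : braid_lk (pres_pi _ w) = eval_word (fun i : 'I_n.-1 => lk_gen i) w.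
  exact: pres_hom_pi.
rewrite (mult_eval_word (@braid_lk n.+1)).
apply: eq_eval_word => i; exact: (pres_hom_gen (@lk_gen_rel n.+1)).
Qed.

Definition Binf_lk : Binf -> linking :=
  @dlim_hom _ (fun n => @add_strand n) linking (fun n => @braid_lk n) add_strand_lk.

HB.instance Definition _ := isMultiplicative.Build Binf linking Binf_lk
  (@dlim_homM _ (fun n => @add_strand n) linking (fun n => @braid_lk n)
     add_strand_lk).

Lemma Binf_lk_sigma i : Binf_lk (sigma i) = lk_gen i.
Proof.
rewrite /Binf_lk /sigma /Binf_in dlim_hom_in.
exact: (pres_hom_gen (@lk_gen_rel i.+2)).
Qed.

Lemma Binf_perm_sigma i : Binf_perm (sigma i) = adj_Sinf i.
Proof.
rewrite /Binf_perm /sigma /Binf_in dlim_hom_in; congr Sinf_of.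
exact: (pres_hom_gen (@adj_tperm_rel i.+2)).
Qed.

(** * Generators of the infinite braid group *)

Lemma Binf_in_add_strand n (x : braid n) : Binf_in (add_strand x) = Binf_in x.
Proof.
rewrite -[RHS](@dlim_in_shift _ _ n n.+1) //.
by rewrite shiftS // shift_id.
Qed.

Lemma Binf_in_gen n (i : 'I_n.-1) : Binf_in (pres_gen (@braid_rel n) i) = sigma i.
Proof.
elim: n i => [|n IHn] [i lt_in] //=.
have [lt_i|le_n] := ltnP i n.-1.
  rewrite -[RHS](IHn (Ordinal lt_i)) -[RHS]Binf_in_add_strand; congr Binf_in.
  rewrite [RHS](pres_hom_gen (@add_strand_rel n)).
  by congr pres_gen; apply: val_inj.
have en : n = i.+1 by move: lt_in le_n => /=; lia.
subst n; congr Binf_in; congr pres_gen; exact: val_inj.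
Qed.

Lemma eval_word_mem (T : choiceType) (G : groupType) (S : subgroup G) (f : T -> G) w :
  (forall x, f x \in S) -> eval_word f w \in S.
Proof.
move=> fS; elim: w => [|[x b] w IHw] /=; first exact: sub1g.
by apply: subMg => //; rewrite /eval_letter; case: b; rewrite ?subVg ?fS.
Qed.

Lemma Binf_generated (S : subgroup Binf) :
  (forall i, sigma i \in S) -> forall x, x \in S.
Proof.
move=> sS x; have [n _ [y ->]] := dlimP x 0.
rewrite -(pres_reprK y); move: (repr y) => w.
have -> : pres_pi _ w = eval_word (pres_gen (@braid_rel n)) w.
  rewrite (eval_word_gen _ id) -[in LHS](map_id w); congr pres_pi.
  by apply: eq_map => -[].
rewrite -[dlim_in _ _]/(Binf_in _) mult_eval_word; apply: eval_word_mem => i.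
by have := sS i; rewrite -Binf_in_gen.
Qed.

Fact equaliser_closed (G H : groupType) (f g : {multiplicative G -> H}) :
  group_closed [pred x | f x == g x].
Proof.
apply: group_closedP => [|x y|x]; rewrite !inE ?mult1 // ?gmulfM ?multV.
- by move=> /eqP-> /eqP->.
- by move=> /eqP->.
Qed.

Lemma Binf_hom_eq (H : groupType) (f g : {multiplicative Binf -> H}) :
  (forall i, f (sigma i) = g (sigma i)) -> f =1 g.
Proof.
move=> fg x; apply/eqP.
apply: (@Binf_generated (Subgroup (equaliser_closed f g))) => i.
exact/eqP/fg.
Qed.

Lemma sigma_braid i :
  sigma i * sigma i.+1 * sigma i = sigma i.+1 * sigma i * sigma i.+1.
Proof.
have lt_i : i < i.+3.-1 by [].
have lt_j : i.+1 < i.+3.-1 by [].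
rewrite -(Binf_in_gen (Ordinal lt_i)) -(Binf_in_gen (Ordinal lt_j)).
rewrite -!gmulfM; congr Binf_in.
have genM a b : pres_gen (@braid_rel i.+3) a * pres_gen _ b * pres_gen _ a =
    pres_pi _ [:: (a, true); (b, true); (a, true)].
  rewrite -mulgA -[X in _ * (_ * X)]mulg1.
  exact: (eval_word_gen _ id [:: (a, true); (b, true); (a, true)]).
by rewrite !genM; apply/pres_piP/PresRel; exact: BraidRel.
Qed.

Lemma sigma_comm i j : i.+1 < j -> commute (sigma i) (sigma j).
Proof.
move=> ij; have lt_i : i < j.+2.-1 by rewrite /=; lia.
have lt_j : j < j.+2.-1 by [].
rewrite /commute -(Binf_in_gen (Ordinal lt_i)) -(Binf_in_gen (Ordinal lt_j)).
rewrite -!gmulfM; congr Binf_in.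
rewrite [LHS]pres_mulE [RHS]pres_mulE.
by apply/pres_piP/PresRel; exact: BraidComm.
Qed.

(** * The quotient by the commutators of pure braids *)

Lemma Binf_lk_perm x : lk_perm (Binf_lk x) = Binf_perm x.
Proof.
apply: (@Binf_hom_eq _ (lk_perm \o Binf_lk) Binf_perm) => i /=.
by rewrite Binf_lk_sigma Binf_perm_sigma.
Qed.

Lemma mem_Pinf x : (x \in Pinf) = (Binf_perm x == 1).
Proof. exact: Pinf_predE. Qed.

(** Elements of the linking group over the trivial permutation commute, so commutators of pure
    braids have trivial image. *)
Fact Binf_lk_derived x : x \in derived Pinf -> Binf_lk x = 1.
Proof.
move=> /asboolP/(_ (kernel Binf_lk)) kx; apply/eqP; apply: kx.
move=> _ [a Pa] [b Pb <-] /=; rewrite inE (multR Binf_lk); apply/commgP.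
by apply: lk_pure_comm; rewrite Binf_lk_perm; apply/eqP; rewrite -mem_Pinf.
Qed.

Definition lk_map : BinfQ -> linking := quot_hom Binf_lk_derived.

HB.instance Definition _ :=
  isMultiplicative.Build BinfQ linking lk_map (quot_homM Binf_lk_derived).

Lemma lk_map_pi x : lk_map (BinfQ_pi x) = Binf_lk x.
Proof. exact: quot_homE. Qed.

Lemma p_map_pi x : p_map (BinfQ_pi x) = Binf_perm x.
Proof. exact: quot_homE. Qed.

Lemma BinfQ_pi_repr u : exists x, u = BinfQ_pi x.
Proof. by exists (repr u); rewrite -[LHS]quot_reprK. Qed.

Lemma lk_perm_map u : lk_perm (lk_map u) = p_map u.
Proof.
by have [x ->] := BinfQ_pi_repr u; rewrite lk_map_pi p_map_pi Binf_lk_perm.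
Qed.

Definition sigmaQ i : BinfQ := BinfQ_pi (sigma i).

Lemma BinfQ_generated (S : subgroup BinfQ) :
  (forall i, sigmaQ i \in S) -> forall u, u \in S.
Proof.
move=> sS u; have [x ->] := BinfQ_pi_repr u.
have cl : group_closed [pred x | BinfQ_pi x \in S].
  apply: group_closedP => [|a b|a]; rewrite !inE ?mult1 ?gmulfM ?multV.
  - exact: sub1g.
  - exact: subMg.
  - exact: subVg.
exact: (@Binf_generated (Subgroup cl)).
Qed.

Lemma p_map_sigmaQ i k : Sinf_fun (p_map (sigmaQ i)) k = adjn i k.
Proof. by rewrite p_map_pi Binf_perm_sigma adj_SinfE. Qed.

Lemma mem_Pinf_ab u : (u \in Pinf_ab) = (p_map u == 1).
Proof.
apply/asboolP/eqP => [[x Px <-]|].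
  by apply/eqP; rewrite p_map_pi -mem_Pinf.
have [x ->] := BinfQ_pi_repr u; rewrite p_map_pi => x1.
by exists x => //; rewrite mem_Pinf x1.
Qed.

Lemma Pinf_ab_comm u v : u \in Pinf_ab -> v \in Pinf_ab -> commute u v.
Proof.
move=> /asboolP[x Px <-] /asboolP[y Py <-]; apply/commgP; rewrite -(multR BinfQ_pi).
rewrite -[1](mult1 BinfQ_pi); apply/eqP/quot_piP; rewrite invg1 mulg1.
by apply/asboolP => S; apply; exists x => //; exists y.
Qed.

Lemma p_map_surj s : exists u, p_map u = s.
Proof. exact: (adjacent_generate p_map_sigmaQ). Qed.

Lemma lk_mapM : {morph lk_map : u v / u * v}.
Proof. exact: quot_homM. Qed.

Lemma lk_map1 : lk_map 1 = 1. Proof. exact: mult1. Qed.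

Lemma lk_mapV u : lk_map u^-1 = (lk_map u)^-1. Proof. exact: multV. Qed.

Lemma p_mapM : {morph p_map : u v / u * v}.
Proof. exact: quot_homM. Qed.

Lemma p_map1 : p_map 1 = 1. Proof. exact: mult1. Qed.

Lemma p_mapV u : p_map u^-1 = (p_map u)^-1. Proof. exact: multV. Qed.

(** * The normal closure of an element *)

Section NormalClosure.
Variables (G : groupType) (z : G).

Definition conjugates : set G := [set z ^ u | u in setT].

Fact normal_closure_normal x y :
  x \in Defs.generated conjugates -> x ^ y \in Defs.generated conjugates.
Proof.
move=> /asboolP zx; apply/asboolP => S zS.
apply: (zx (Subgroup (conj_preim_closed S y))) => _ [u _ <-] /=.
by rewrite unfold_in -conjgM; apply: zS; exists (u * y).
Qed.

Definition normal_closure := NormalSubgroup normal_closure_normal.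

Lemma mem_normal_closure u : z ^ u \in normal_closure.
Proof. by apply/asboolP => S; apply; exists u. Qed.

Lemma normal_closure_sub (S : subgroup G) :
  (forall u, z ^ u \in S) -> forall x, x \in normal_closure -> x \in S.
Proof. by move=> zS x /asboolP; apply => _ [u _ <-]; exact: zS. Qed.

End NormalClosure.

(** * Pure braids are products of conjugates of [sigma 0 ^+ 2] *)

Definition zQ : BinfQ := sigmaQ 0 ^+ 2.

Lemma sigmaQ_comm i j : i.+1 < j -> commute (sigmaQ i) (sigmaQ j).
Proof. by move=> ij; apply: gmulf_commute; exact: sigma_comm. Qed.

Lemma sigmaQ_braid i :
  sigmaQ i * sigmaQ i.+1 * sigmaQ i = sigmaQ i.+1 * sigmaQ i * sigmaQ i.+1.
Proof. by have := congr1 BinfQ_pi (sigma_braid i); rewrite !gmulfM. Qed.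

(** The braid relation says that [sigmaQ i.+1 * sigmaQ i] conjugates [sigmaQ i] to [sigmaQ i.+1]. *)
Lemma sigmaQ_conj i : exists u, sigmaQ i = sigmaQ 0 ^ u.
Proof.
elim: i => [|i [u IHi]]; first by exists 1; rewrite conjg1.
exists (u * (sigmaQ i.+1 * sigmaQ i)); rewrite conjgM -IHi conjgE.
by rewrite (mulgA (sigmaQ i)) sigmaQ_braid mulKg.
Qed.

Lemma p_map_sigmaQ_sq i : p_map (sigmaQ i ^+ 2) = 1.
Proof.
rewrite multX expg2; apply: SinfP => k.
by rewrite SinfM !p_map_sigmaQ adjnK.
Qed.

Lemma p_map_conj u v : p_map u = 1 -> p_map (u ^ v) = 1.
Proof. by move=> pu; rewrite multJ /= pu conj1g. Qed.

(** Modulo the normal closure [N] of [zQ] the generators satisfy the Coxeter relations, so a class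
    with trivial permutation becomes trivial in the quotient by [N]. *)
Lemma Pinf_ab_spanned u : u \in Pinf_ab -> u \in normal_closure zQ.
Proof.
rewrite mem_Pinf_ab => /eqP pu.
pose N := normal_closure zQ.
have pN x : x \in N -> p_map x = 1.
  move=> Nx; apply/eqP; rewrite -mem_Pinf_ab; move: x Nx.
  by apply: normal_closure_sub => v; rewrite mem_Pinf_ab p_map_conj ?p_map_sigmaQ_sq.
pose t i : quot_group N := quot_pi N (sigmaQ i).
have t_sq i : t i * t i = 1.
  rewrite -gmulfM -[1](mult1 (quot_pi N)); apply/quot_piP.
  have [v ->] := sigmaQ_conj i.
  by rewrite invg1 mulg1 -conjMg -expg2; exact: mem_normal_closure.
have t_braid i : t i * t i.+1 * t i = t i.+1 * t i * t i.+1.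
  by have := congr1 (quot_pi N) (sigmaQ_braid i); rewrite !gmulfM.
have t_comm i j : i.+1 < j -> commute (t i) (t j).
  by move=> ij; apply: gmulf_commute; exact: sigmaQ_comm.
have pi_t i k : Sinf_fun (quot_hom pN (t i)) k = adjn i k.
  by rewrite quot_homE p_map_sigmaQ.
(* The [t i] are involutions, so words without inverse letters already form a subgroup. *)
have prodV (w : seq nat) : (\prod_(i <- w) t i)^-1 = \prod_(i <- rev w) t i.
  elim: w => [|i w IHw]; first by rewrite !big_nil invg1.
  rewrite rev_cons big_rcons big_cons invgM IHw /=; congr (_ * _).
  exact/mulg1_eq/t_sq.
have cl : group_closed
    [pred x | `[< exists w : seq nat, quot_pi N x = \prod_(i <- w) t i >]].
  apply: group_closedP => [|x y|x]; rewrite !inE.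
  - by exists [::]; rewrite big_nil mult1.
  - move=> [w ew] [w' ew']; exists (w ++ w').
    by rewrite big_cat gmulfM /= ew ew'.
  - by move=> [w ew]; exists (rev w); rewrite multV /= ew.
have /asboolP[w ew] : u \in Subgroup cl.
  by apply: BinfQ_generated => i; apply/asboolP; exists [:: i]; rewrite big_seq1.
have : quot_pi N u = quot_pi N 1.
  rewrite mult1 ew; apply: (coxeter_presentation t_sq t_braid t_comm pi_t).
  by rewrite -ew; apply: etrans (quot_homE pN u) pu.
by move=> /quot_piP; rewrite invg1 mulg1.
Qed.

(** The class [u * v^-1] stabilises [{0, 1}]. By [stabiliser_commute] it centralises [zQ], which
    commutes with [sigmaQ 0], with every [sigmaQ j] for [j > 1], and with all pure classes. *)
Lemma zQ_conj_eq u v :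
    P2_act (p_map u) (P2_adj 0) = P2_act (p_map v) (P2_adj 0) ->
  zQ ^ u = zQ ^ v.
Proof.
move=> euv; suff zuv : commute zQ (u * v^-1).
  by rewrite -[u in LHS](mulgVK v) conjgM; congr (_ ^ _); rewrite conjgE zuv mulKg.
have : P2_act (p_map (u * v^-1)) (P2_adj 0) == P2_adj 0.
  by rewrite gmulfM multV P2_actM euv P2_actK.
rewrite P2_adjE P2_act_mk // P2_mk_eq ?(inj_eq (@Sinf_inj _)) // => suv.
have [y0 y1] : Sinf_fun (p_map (u * v^-1)) 0 < 2 /\ Sinf_fun (p_map (u * v^-1)) 1 < 2.
  by lia.
apply: (stabiliser_commute p_map_sigmaQ) y0 y1; [| |move=> y py].
- by apply: commute_sym; exact: commuteX.
- by move=> j j1; apply/commute_sym/commuteX/commute_sym/sigmaQ_comm.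
- by apply: Pinf_ab_comm; rewrite mem_Pinf_ab ?p_map_sigmaQ_sq ?py.
Qed.

(** * Linking numbers characterise the classes of braids *)

Lemma lk_num_sigmaQ_sq i A :
  lk_num (lk_map (sigmaQ i ^+ 2)) A = (2 * (A == P2_adj i)%:R)%R.
Proof.
have -> : lk_map (sigmaQ i ^+ 2) = lk_gen i * lk_gen i.
  by rewrite expg2 lk_mapM lk_map_pi Binf_lk_sigma.
rewrite lk_numM !lk_num_gen lk_perm_gen P2_act_adj_eq mulr_natl mulr2n.
rewrite {2}P2_adjE P2_act_adj ?ltn_eqF // [P2_mk _ _]P2_mkC /adjn eqxx.
by rewrite eqxx gtn_eqF // -P2_adjE.
Qed.

Lemma lk_num_conj x y A : lk_perm x = 1 ->
  lk_num (x ^ y) A = lk_num x (P2_act (lk_perm y)^-1 A).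
Proof.
move=> x1; rewrite conjgE !lk_numM lk_numV multV x1 P2_act1.
by rewrite addrCA addNr addr0.
Qed.

Lemma lk_num_sigmaQ_sq_conj i u A :
  lk_num (lk_map ((sigmaQ i ^+ 2) ^ u)) A =
    (2 * (A == P2_act (p_map u) (P2_adj i))%:R)%R.
Proof.
rewrite (multJ lk_map) lk_num_conj ?lk_perm_map ?p_map_sigmaQ_sq // lk_num_sigmaQ_sq.
by rewrite -(inj_eq (@P2_act_inj (p_map u))) P2_actVK.
Qed.

Definition Sinf_swap_fun (i j k : nat) := if k == i then j else if k == j then i else k.

Fact Sinf_swap_proof i j : finsupp_perm (Sinf_swap_fun i j).
Proof.
apply/asboolP; split.
  apply: inv_bij => k; rewrite /Sinf_swap_fun.
  by have [->|] := eqVneq k i; [|have [->|] := eqVneq k j]; do ![case: eqP] => *; lia.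
apply: (@sub_finite_set _ _ [set i; j]); last exact: finite_set2.
by move=> k; rewrite /Sinf_swap_fun /=; case: eqP; [left|case: eqP => //; right].
Qed.

Definition Sinf_swap i j : Sinf := exist _ (Sinf_swap_fun i j) (Sinf_swap_proof i j).

Lemma P2_transitive A : exists s, P2_act s (P2_adj 0) = A.
Proof.
have [i [j [ij ->]]] := P2_mkP A.
(* The first swap carries [0] to [i]; the second carries the image of [1] to [j] and fixes [i]. *)
exists (Sinf_swap 0 i * Sinf_swap (Sinf_swap 0 i 1%N) j).
rewrite P2_adjE P2_act_mk // !SinfM; congr P2_mk;
  rewrite /Sinf_fun /= /Sinf_swap_fun /=; case: i ij => [|[|i]] ij //=;
  do ![case: eqP] => //; lia.
Qed.

Lemma exists_BinfQ_over A : exists u, P2_act (p_map u) (P2_adj 0) = A.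
Proof.
have [s sA] := P2_transitive A; have [u us] := p_map_surj s.
by exists u; rewrite us.
Qed.

(** A second, additive structure on the pure classes, for which the universal property of
    [{freeg P2}] can be used. *)
Definition pureQ : Type := subgroup_of Pinf_ab.

HB.instance Definition _ := SubGroup.on pureQ.

Fact pureQ_addC : commutative (fun u v : pureQ => u * v).
Proof.
move=> u v; apply: val_inj; rewrite !valM.
by apply: Pinf_ab_comm; exact: valP.
Qed.

HB.instance Definition _ := GRing.isZmodule.Build pureQ
  (@mulgA pureQ) pureQ_addC (@mul1g pureQ) (@mulVg pureQ).

Definition lk_coord (A : P2) (u : pureQ) : int := lk_num (lk_map (val u)) A.

Lemma p_map_val (u : pureQ) : p_map (val u) = 1.
Proof. by apply/eqP; rewrite -mem_Pinf_ab; exact: valP. Qed.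

Fact lk_coord_additive A : additive (lk_coord A).
Proof.
move=> u v; rewrite /lk_coord.
have -> : val (u - v)%R = val u * (val v)^-1.
  by rewrite -(multV (val : pureQ -> BinfQ)) -(valM u).
rewrite lk_mapM lk_mapV lk_numM lk_numV lk_perm_map !p_map_val.
by rewrite lk_perm_map p_map_val invg1 !P2_act1.
Qed.

HB.instance Definition _ A :=
  GRing.isAdditive.Build pureQ int (lk_coord A) (lk_coord_additive A).

Lemma zQ_conj_pure u : zQ ^ u \in Pinf_ab.
Proof. by rewrite mem_Pinf_ab p_map_conj ?p_map_sigmaQ_sq. Qed.

(** The map [g] sends a basis vector [A] to a conjugate of [zQ] linking the pair [A]. It is onto
    because such conjugates span the pure classes and depend on [A] only; the coordinates recover
    [D]. *)
Lemma pureQ_freeg : exists g : {freeg P2} -> pureQ,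
  (forall D A, lk_coord A (g D) = (2 * coeff A D)%R) /\ forall u, exists D, u = g D.
Proof.
have [v vE] := choice exists_BinfQ_over.
pose e A : zmodule pureQ := Sub (zQ ^ v A) (zQ_conj_pure (v A)) : pureQ.
have eE A B : lk_coord A (e B) = (2 * (B == A)%:R)%R.
  by rewrite /lk_coord SubK lk_num_sigmaQ_sq_conj vE eq_sym.
exists (fglift e); split => [D A|u].
  rewrite -(freeg_repr D) fglift_Freeg coeff_Freeg; move: (repr D : seq _) => s.
  elim: s => [|[k B] s IHs].
    by rewrite prelift_nil precoeff_nil mulr0; exact: (raddf0 (lk_coord A)).
  rewrite prelift_cons precoeff_cons mulrDr -IHs.
  have -> : (2 * ((B == A)%:R * k) = lk_coord A (k *: e B)%R)%R.
    rewrite scalezrE [RHS](raddfMz (lk_coord A)) /= eE -mulrzr intz.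
    by rewrite -mulrA.
  exact: (raddfD (lk_coord A)).
pose S (x : BinfQ) := `[< exists D, x = val (fglift e D : pureQ) >].
have clS : group_closed S.
  have gB := lift_is_additive e; split => [|x y].
    by apply/asboolP; exists 0%R; rewrite -(subrr 0%R) gB subrr.
  move=> /asboolP[D ->] /asboolP[D' ->]; apply/asboolP; exists (D - D')%R.
  by rewrite gB.
suff /asboolP[D eD] : val u \in Subgroup clS by exists D; exact: val_inj.
apply: (normal_closure_sub (z := zQ)) => [w|]; last exact: Pinf_ab_spanned (valP u).
apply/asboolP; exists (free_basis (P2_act (p_map w) (P2_adj 0))).
by rewrite liftU scale1r SubK; apply: zQ_conj_eq; rewrite vE.
Qed.

Lemma freeg_of_finite (K : choiceType) (a : K -> int) :
  finite_set [set k | a k != 0%R] -> exists D : {freeg K}, forall k, coeff k D = a k.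
Proof.
move=> fin_a; pose r := fset_set [set k | a k != 0%R].
exists [freeg [seq (a k, k) | k <- r]] => k; rewrite coeff_Freeg.
have dom_r : predom [seq (a k, k) | k <- r] = r by rewrite /predom -map_comp map_id.
have mem_r : (k \in (r : seq K)) = (a k != 0%R).
  by rewrite in_fset_set //; apply/idP/idP => [/set_mem|/mem_set].
have [ak|ak] := eqVneq (a k) 0%R.
  by rewrite precoeff_outdom // dom_r mem_r ak eqxx.
rewrite (@precoeff_mem_uniqE _ _ _ (a k, k)) ?dom_r ?fset_uniq //.
by apply/mapP; exists k; rewrite ?mem_r.
Qed.

Lemma freeg_finite (K : choiceType) (D : {freeg K}) :
  finite_set [set k | coeff k D != 0%R].
Proof.
apply: (@sub_finite_set _ _ [set` dom D]); last exact: finite_seq.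
by move=> k /=; rewrite mem_dom.
Qed.

Lemma lk_lift_freeg (D : {freeg P2}) : exists2 u, p_map u = 1 &
  forall A, lk_num (lk_map u) A = (2 * coeff A D)%R.
Proof.
have [g [gE _]] := pureQ_freeg; exists (val (g D)); first exact: p_map_val.
by move=> A; exact: gE.
Qed.

Lemma lk_num_pure u : p_map u = 1 ->
  exists D : {freeg P2}, forall A, lk_num (lk_map u) A = (2 * coeff A D)%R.
Proof.
move=> /eqP; rewrite -mem_Pinf_ab => Pu; have [g [gE g_surj]] := pureQ_freeg.
by have [D eD] := g_surj (Sub u Pu : pureQ); exists D => A; rewrite -gE -eD.
Qed.

(** A class in the kernel is pure, hence of the form [g D], and its linking numbers determine
    [D]. *)
Lemma lk_map_inj : injective lk_map.
Proof.
move=> u v euv; apply: divg1_eq; set w := u * v^-1.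
have lw : lk_map w = 1 by rewrite lk_mapM lk_mapV euv mulgV.
have Pw : w \in Pinf_ab by rewrite mem_Pinf_ab -lk_perm_map lw.
have [g [gE g_surj]] := pureQ_freeg.
have [D eD] := g_surj (Sub w Pw : pureQ); have [E eE] := g_surj (1 : pureQ).
suff DE : D = E by rewrite -[LHS](SubK pureQ Pw) eD DE -eE.
apply/eqP/freeg_eqP => A; apply: (@mulfI _ 2%R) => //.
by rewrite -!gE -eD -eE /lk_coord SubK lw lk_map1.
Qed.

(** * The image of [lk_map]: finite support and parity *)

Lemma lk_finite u : finite_set [set A | lk_num (lk_map u) A != 0%R].
Proof.
pose S u := `[< finite_set [set A | lk_num (lk_map u) A != 0%R] >].
suff /asboolP : u \in (S : {pred BinfQ}) by [].
have clS : group_closed S.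
  have fin_act s (a : P2 -> int) : finite_set [set A | a A != 0%R] ->
      finite_set [set A | a (P2_act s A) != 0%R].
    move=> fin_a; apply: (finite_preimage (f := P2_act s)) fin_a.
    by move=> A B _ _; exact: P2_act_inj.
  apply: group_closedP => [|x y /asboolP fx /asboolP fy|x /asboolP fx]; apply/asboolP.
  - rewrite (_ : [set _ | _] = set0) //; apply/seteqP; split => // A /=.
    by rewrite lk_map1 lk_num1 eqxx.
  - apply: (@sub_finite_set _ _ ([set A | lk_num (lk_map x) A != 0%R] `|`
      [set A | lk_num (lk_map y) (P2_act (lk_perm (lk_map x)) A) != 0%R])); last first.
      by rewrite finite_setU; split => //; exact: fin_act.
    move=> A /=; rewrite lk_mapM lk_numM.
    have [->|] := eqVneq (lk_num (lk_map x) A) 0%R; last by left.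
    by rewrite add0r; right.
  - have := fin_act (lk_perm (lk_map x))^-1 _ fx.
    apply: sub_finite_set => A /=.
    by rewrite lk_mapV lk_numV oppr_eq0.
apply: (@BinfQ_generated (Subgroup clS)) => i; apply/asboolP.
apply: (@sub_finite_set _ _ [set P2_adj i]); last exact: finite_set1.
move=> A /=; rewrite lk_map_pi Binf_lk_sigma lk_num_gen.
by have [->|] := eqVneq A (P2_adj i); rewrite ?eqxx.
Qed.

Lemma odd_abszD (a b : int) : odd `|(a + b)%R|%N = odd `|a|%N (+) odd `|b|%N.
Proof. by lia. Qed.

(** Both sides are additive along products, so generators suffice: [sigmaQ k] only reverses the
    order of [k] and [k.+1]. *)
Lemma lk_parity u i j : i != j ->
  odd `|lk_num (lk_map u) (P2_mk i j)|%N =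
    (i < j) (+) (Sinf_fun (p_map u) i < Sinf_fun (p_map u) j).
Proof.
pose S u := `[< forall i j, i != j -> odd `|lk_num (lk_map u) (P2_mk i j)|%N =
    (i < j) (+) (Sinf_fun (p_map u) i < Sinf_fun (p_map u) j) >].
suff /asboolP : u \in (S : {pred BinfQ}) by apply.
have clS : group_closed S.
  apply: group_closedP => [|x y /asboolP Sx /asboolP Sy|x /asboolP Sx]; apply/asboolP.
  - by move=> k l _; rewrite lk_map1 p_map1 addbb.
  - move=> k l kl; rewrite lk_mapM lk_numM odd_abszD Sx // lk_perm_map.
    rewrite P2_act_mk // Sy ?(inj_eq (@Sinf_inj _)) // p_mapM !SinfM.
    by rewrite addbA addbK.
  - move=> k l kl; rewrite lk_mapV lk_numV abszN lk_perm_map p_mapV P2_act_mk //.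
    by rewrite Sx ?(inj_eq (@Sinf_inj _)) // !SinfVK addbC.
apply: (@BinfQ_generated (Subgroup clS)) => k; apply/asboolP => a b ab.
rewrite lk_map_pi Binf_lk_sigma lk_num_gen !p_map_sigmaQ P2_adjE.
rewrite P2_mk_eq //; last by rewrite ltn_eqF.
have odd_nat (c : bool) : odd `|(c%:R : int)%R|%N = c by case: c.
by rewrite odd_nat /adjn; do ![case: ifP]; lia.
Qed.

(** Any class [v] over [s] can be corrected by a pure class: [a] and the numbers of [v] have the
    same parities by [lk_parity], so their difference is twice an element of [{freeg P2}]. *)
Lemma lk_lift (a : P2 -> int) (s : Sinf) : finite_set [set A | a A != 0%R] ->
    (forall i j, i != j -> odd `|a (P2_mk i j)|%N = (i < j) (+) (s i < s j)) ->
  exists2 u, p_map u = s & lk_num (lk_map u) =1 a.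
Proof.
move=> fin_a odd_a; have [v vs] := p_map_surj s.
pose b A := (a A - lk_num (lk_map v) A)%R.
have even_b A : (b A = 2 * (b A %/ 2)%Z)%R.
  have [i [j [/ltn_eqF/negbT ij ->]]] := P2_mkP A.
  have : ~~ odd `|b (P2_mk i j)|%N.
    by rewrite odd_abszD abszN odd_a // lk_parity // vs addbb.
  by lia.
have [D DE] : exists D : {freeg P2}, forall A, coeff A D = (b A %/ 2)%Z.
  apply: freeg_of_finite; have := lk_finite v => fin_v.
  apply: (@sub_finite_set _ _ ([set A | a A != 0%R] `|`
    [set A | lk_num (lk_map v) A != 0%R])); last by rewrite finite_setU.
  move=> A /=; rewrite /b; have [->|] := eqVneq (a A) 0%R; last by left.
  by have [->|] := eqVneq (lk_num _ A) 0%R; [rewrite subr0 div0z eqxx|right].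
have [w w1 wE] := lk_lift_freeg D; exists (w * v).
  by rewrite p_mapM w1 mul1g.
by move=> A; rewrite lk_mapM lk_numM wE DE -even_b lk_perm_map w1 P2_act1 subrK.
Qed.

Lemma inj_surj_bij (X Y : Type) (f : X -> Y) :
  injective f -> (forall y, exists x, f x = y) -> bijective f.
Proof.
move=> f_inj /choice[g fg]; exists g => // x.
by apply: f_inj; rewrite fg.
Qed.

Lemma lk_num_pureM u v A : p_map u = 1 ->
  lk_num (lk_map (u * v)) A = (lk_num (lk_map u) A + lk_num (lk_map v) A)%R.
Proof. by move=> u1; rewrite lk_mapM lk_numM lk_perm_map u1 P2_act1. Qed.

Lemma double_inj : injective (fun k : int => (2 * k)%R).
Proof. exact: mulfI. Qed.

Lemma lk_map_eq u v :
  p_map u = p_map v -> lk_num (lk_map u) =1 lk_num (lk_map v) -> u = v.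
Proof. by move=> puv nuv; apply/lk_map_inj/lkP; rewrite // !lk_perm_map. Qed.

(** The coefficients of [f x] are half the entries of [lk_num]. *)
Theorem Pinf_ab_free : exists f : subgroup_of Pinf_ab -> {freeg P2},
  iso_add f /\
  forall (b : Binf) (i : nat) (x : subgroup_of Pinf_ab),
    val x = BinfQ_pi ((sigma i ^+ 2) ^ b) ->
    f x = free_basis (P2_act (Binf_perm b) (P2_adj i)).
Proof.
have p1 (x : subgroup_of Pinf_ab) : p_map (val x) = 1 by exact: p_map_val.
have [f fE] := choice (fun x : subgroup_of Pinf_ab => lk_num_pure (p1 x)).
exists f; split; first split.
- apply: inj_surj_bij => [x y fxy|D].
    apply: val_inj; apply: lk_map_eq => [|A]; first by rewrite !p1.
    by rewrite !fE fxy.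
  have [u u1 uE] := lk_lift_freeg D.
  have Pu : u \in Pinf_ab by rewrite mem_Pinf_ab u1.
  exists (Sub u Pu); apply/eqP/freeg_eqP => A; apply: double_inj.
  by rewrite -fE SubK uE.
- move=> x y; apply/eqP/freeg_eqP => A; apply: double_inj.
  by rewrite -fE valM lk_num_pureM // coeffD mulrDr -!fE.
- move=> b i x ex; apply/eqP/freeg_eqP => A; apply: double_inj.
  rewrite -fE ex multJ multX /= -/(sigmaQ i) lk_num_sigmaQ_sq_conj p_map_pi.
  by rewrite coeffU mul1r eq_sym.
Qed.

(** * Finite subgroups of the quotient *)

(** Linking numbers are additive on pure classes, and [int] has no torsion. *)
Lemma pure_torsion_free (u : BinfQ) m : p_map u = 1 -> 0 < m -> u ^+ m = 1 -> u = 1.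
Proof.
move=> u1 m_gt0 um; apply: lk_map_eq => [|A]; first by rewrite u1 p_map1.
have numX k : lk_num (lk_map (u ^+ k)) A = (lk_num (lk_map u) A *+ k)%R.
  elim: k => [|k IHk]; first by rewrite lk_map1.
  by rewrite expgS lk_num_pureM // IHk mulrS.
have := numX m; rewrite um lk_map1 lk_num1 => /esym/eqP.
by rewrite Num.Theory.mulrn_eq0 -[m == _]negbK -lt0n m_gt0 => /eqP.
Qed.

Lemma BinfQ_no_involution (u : BinfQ) : u ^+ 2 = 1 -> u = 1.
Proof.
move=> u2; have [pu|/eqP pu] := pselect (p_map u = 1).
  exact: pure_torsion_free pu _ u2.
have [i si] : exists i, Sinf_fun (p_map u) i <> i.
  apply: contrapT => no_i; case/eqP: pu; apply: SinfP => i.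
  by apply: contrapT => si; apply: no_i; exists i.
set s := p_map u in pu si; have ssi : s (s i) = i.
  by rewrite -SinfM -p_mapM -expg2 u2 p_map1.
have nij : i != s i by apply/eqP => /esym.
have : lk_num (lk_map (u * u)) (P2_mk i (s i)) = 0%R.
  by rewrite -expg2 u2 lk_map1.
rewrite lk_mapM lk_numM lk_perm_map P2_act_mk // -/s ssi [P2_mk (s i) i]P2_mkC => num0.
(* The number of [{i, s i}] is zero because its double is, yet it is odd because [s] exchanges the
   two points. *)
have := lk_parity u nij; rewrite -/s ssi; lia.
Qed.

(** The quotient [u * v^-1] is both pure and of finite order. *)
Lemma p_map_inj_finite (Gt : subgroup BinfQ) : finite_subgroup Gt ->
  forall u v, u \in Gt -> v \in Gt -> p_map u = p_map v -> u = v.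
Proof.
move=> finG u v Gu Gv puv; apply: divg1_eq.
have [m m_gt0 em] := finite_subgroup_torsion finG (subMg Gu (subVg Gv)).
by apply: pure_torsion_free m_gt0 em; rewrite p_mapM p_mapV puv mulgV.
Qed.

Theorem finite_subgroup_BinfQ (Gt : subgroup BinfQ) : finite_subgroup Gt ->
  odd (subgroup_order Gt) /\ set_bij [set` Gt] (p_map @` [set` Gt]) p_map.
Proof.
move=> finG; split.
  by apply: no_involution_odd => // u _; exact: BinfQ_no_involution.
split => // [u v /set_mem Gu /set_mem Gv puv].
exact: (p_map_inj_finite finG).
Qed.

(** * Sections over finite subgroups of odd order *)

Section FinitePermutations.
Variable G : subgroup Sinf.
Hypothesis finG : finite_subgroup G.

Lemma finite_Sinf_bound : exists n, forall (g : Sinf) m, g \in G -> n <= m -> g m = m.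
Proof.
have [N NE] := choice Sinf_bound; exists (\max_(g <- fset_set [set` G]) N g) => g m Gg.
move=> le_m; apply: NE; apply: leq_trans le_m.
by apply: (@leq_bigmax_seq _ _ xpredT N) => //; rewrite mem_fset_subgroup.
Qed.

Hypothesis oddG : odd (subgroup_order G).

(** Odd powers of [g] send [i] to [j], and one of them is trivial. *)
Lemma odd_no_swap (g : Sinf) i j : g \in G -> g i = j -> g j = i -> i = j.
Proof.
move=> Gg gi gj; have [m oddm gm] := odd_order_exponent finG oddG Gg.
have gE k : Sinf_fun (g ^+ k) i = if odd k then j else i.
  by elim: k => [|k IHk] //; rewrite expgSr SinfM IHk /=; case: odd.
by have := gE m; rewrite gm oddm.
Qed.

(** Choose an ordered pair [r i j] among the translates of [(i, j)] and [(j, i)], the same for the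
    whole orbit of [{i, j}], and let [o i j] say that it is a translate of [(i, j)]. By
    [odd_no_swap] it cannot be a translate of both. *)
Lemma invariant_tournament : exists o : nat -> nat -> bool,
  (forall i j, i != j -> o j i = ~~ o i j) /\
  (forall (g : Sinf) i j, g \in G -> o (g i) (g j) = o i j).
Proof.
pose C (i j : nat) : set (nat * nat) :=
  [set q | exists2 g : Sinf, g \in G & q = (g i, g j) \/ q = (g j, g i)].
have CC i j : C j i = C i j.
  by apply/seteqP; split => q [g Gg /= e]; exists g => //; tauto.
have CG (g : Sinf) i j : g \in G -> C (g i) (g j) = C i j.
  move=> Gg; apply/seteqP; split => q [h Gh /= e].
    by exists (g * h); [exact: subMg | rewrite !SinfM].
  by exists (g^-1 * h); [apply/subMg/Gh/subVg | rewrite !SinfM !SinfK].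
pose r i j := xget (0, 0)%N (C i j).
have rC i j : C i j (r i j).
  by apply: (xgetPex _ (ex_intro _ (i, j) _)); exists 1; [exact: sub1g | left].
pose o i j := `[< exists2 g : Sinf, g \in G & r i j = (g i, g j) >].
exists o; split => [i j ij|g i j Gg].
  have [g Gg re] := rC i j.
  have ne (h k : Sinf) : h \in G -> k \in G -> (h i, h j) <> (k j, k i).
    move=> Gh Gk [hi hj]; move/eqP: ij; apply.
    apply: (@odd_no_swap (h * k^-1)); first exact/subMg/subVg.
      by rewrite SinfM hi SinfK.
    by rewrite SinfM hj SinfK.
  have rji : r j i = r i j by rewrite /r CC.
  rewrite /o rji; case: re => re.
    have -> : `[< exists2 g : Sinf, g \in G & r i j = (g i, g j) >] = true.
      by apply/asboolP; exists g.
    by apply/asboolP => -[h Gh]; rewrite re; exact: ne.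
  have -> : `[< exists2 g : Sinf, g \in G & r i j = (g j, g i) >] = true.
    by apply/asboolP; exists g.
  by apply/esym/asboolP => -[h Gh]; rewrite re => /esym; exact: ne.
have rg : r (g i) (g j) = r i j by rewrite /r CG.
rewrite /o rg; apply/asboolP/asboolP => -[h Gh ->].
  by exists (g * h); [exact: subMg | rewrite !SinfM].
by exists (g^-1 * h); [apply/subMg/Gh/subVg | rewrite !SinfM !SinfK].
Qed.

End FinitePermutations.

Lemma P2_symmetric_fun (T : Type) (v : nat -> nat -> T) :
    (forall i j, i != j -> v j i = v i j) ->
  exists w : P2 -> T, forall i j, i != j -> w (P2_mk i j) = v i j.
Proof.
move=> vC; have [r rE] := choice (fun A => P2_mkP A).
have [r' r'E] := choice rE.
exists (fun A => v (r A) (r' A)) => i j ij.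
have [lt_r e] := r'E (P2_mk i j).
move/eqP: e; rewrite P2_mk_eq //; last by rewrite ltn_eqF.
by move=> /orP[]/andP[/eqP<- /eqP<-] //; rewrite vC.
Qed.

(* The cocycle of the section is the coboundary of the function [w] which
   records the pairs where an invariant tournament disagrees with [<]. *)
Theorem section_exists (G : subgroup Sinf) :
    finite_subgroup G -> odd (subgroup_order G) ->
  exists s : {multiplicative subgroup_of G -> BinfQ}, forall g, p_map (s g) = val g.
Proof.
move=> finG oddG; have [n nG] := finite_Sinf_bound finG.
have [o [oC oG]] := invariant_tournament finG oddG.
have ltG (g : Sinf) i : g \in G -> (g i < n) = (i < n).
  move=> Gg; have [le_ni|lt_in] := leqP n i; first by rewrite nG // ltnNge le_ni.
  rewrite ltnNge; apply/negP => le_n; have /Sinf_inj e := nG g _ Gg le_n.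
  by move: le_n; rewrite e leqNgt lt_in.
(* Pairs with a point outside [[0, n)] get the value [0]: this keeps the support of [w] finite, and
   [G] does not reverse their order. *)
pose v (i j : nat) : int := Posz [&& i < n, j < n & (i < j) (+) o i j].
have [w wE] : exists w : P2 -> int, forall i j, i != j -> w (P2_mk i j) = v i j.
  apply: P2_symmetric_fun => i j ij; rewrite /v oC // andbCA.
  by do 3![congr (_ _)]; congr (_ && _); case: (o i j); lia.
have w_fin : finite_set [set A | w A != 0%R].
  pose I := [set` iota 0 n].
  have finI : finite_set I by exact: finite_seq.
  apply: (@sub_finite_set _ _ ((fun q => P2_mk q.1 q.2) @` (I `*` I))); last first.
    exact/finite_image/finite_setX.
  move=> A /=; have [i [j [/ltn_eqF/negbT ij ->]]] := P2_mkP A.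
  rewrite wE // /v; case: and3P => // -[lt_in lt_jn _] _.
  by exists (i, j) => //; split; rewrite /I /= mem_iota.
pose a (g : Sinf) A := (w (P2_act g A) - w A)%R.
have aL (g : subgroup_of G) :
    exists u, p_map u = val g /\ lk_num (lk_map u) =1 a (val g).
  have Gg := valP g; set h : Sinf := val g in Gg *.
  suff [u pu nu] : exists2 u, p_map u = h & lk_num (lk_map u) =1 a h by exists u.
  apply: lk_lift.
    apply: (@sub_finite_set _ _ ([set A | w (P2_act h A) != 0%R] `|`
      [set A | w A != 0%R])); last first.
      rewrite finite_setU; split => //; apply: (finite_preimage (f := P2_act h)) w_fin.
      by move=> A B _ _; exact: P2_act_inj.
    move=> A /=; rewrite /a; have [->|] := eqVneq (w (P2_act h A)) 0%R; last by left.
    by rewrite sub0r oppr_eq0; right.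
  (* Modulo 2 the invariant term [o i j] cancels, which leaves the inversion parity of [h]. *)
  move=> i j ij; rewrite /a P2_act_mk // !wE ?(inj_eq (@Sinf_inj _)) // /v oG //.
  rewrite !ltG //; have [lt_i|le_i] := ltnP i n; have [lt_j|le_j] := ltnP j n => /=.
  - by case: (o i j); case: (i < j); case: (h i < h j).
  - have hi : h i < n by rewrite ltG.
    by rewrite (nG h j) //=; lia.
  - have hj : h j < n by rewrite ltG.
    by rewrite (nG h i) //=; lia.
  - by rewrite (nG h i) // (nG h j) //=; lia.
have [s sE] := choice aL.
have sM : {morph s : g h / g * h}.
  move=> g h; apply: lk_map_eq => [|A].
    by rewrite p_mapM !(sE _).1 valM.
  rewrite lk_mapM lk_numM lk_perm_map !(sE _).2 (sE g).1 /a valM P2_actM.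
  by rewrite [RHS]addrC subrKA.
pose sm := isMultiplicative.Build _ _ s sM.
pose S : {multiplicative subgroup_of G -> BinfQ} := HB.pack s sm.
by exists S => g; exact: (sE g).1.
Qed.

(** * Conjugacy of two sections *)

Section TwoSections.
Variables (G : subgroup Sinf) (s s' : {multiplicative subgroup_of G -> BinfQ}).
Hypothesis finG : finite_subgroup G.
Hypothesis sE : forall g, p_map (s g) = val g.
Hypothesis s'E : forall g, p_map (s' g) = val g.

Implicit Types (g h k : subgroup_of G) (A B : P2).

Lemma section_num (t : {multiplicative subgroup_of G -> BinfQ}) g h A :
    (forall g, p_map (t g) = val g) ->
  lk_num (lk_map (t (g * h))) A =
    (lk_num (lk_map (t g)) A + lk_num (lk_map (t h)) (P2_act (val g) A))%R.
Proof. by move=> tE; rewrite gmulfM lk_mapM lk_numM lk_perm_map tE. Qed.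

(** Here [d g] gives the coordinates of the pure class [s' g * (s g)^-1]; the second clause is the
    cocycle identity. *)
Lemma section_diff : exists d : subgroup_of G -> {freeg P2},
  [/\ forall g A, lk_num (lk_map (s' g)) A =
                    (lk_num (lk_map (s g)) A + 2 * coeff A (d g))%R
    & forall g h A, coeff A (d (g * h)) =
                      (coeff A (d g) + coeff (P2_act (val g) A) (d h))%R].
Proof.
have pure g : p_map (s' g * (s g)^-1) = 1 by rewrite p_mapM p_mapV sE s'E mulgV.
have [d dE] := choice (fun g => lk_num_pure (pure g)).
have num_s' g A : lk_num (lk_map (s' g)) A =
    (lk_num (lk_map (s g)) A + 2 * coeff A (d g))%R.
  by rewrite -dE addrC -lk_num_pureM // mulgVK.
exists d; split => // g h A; apply: double_inj.
apply: (addrI (lk_num (lk_map (s (g * h))) A)).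
rewrite /= -num_s' !section_num // !num_s' mulrDr.
by rewrite addrACA.
Qed.

Variable d : subgroup_of G -> {freeg P2}.
Hypothesis d_cocycle : forall g h A,
  coeff A (d (g * h)) = (coeff A (d g) + coeff (P2_act (val g) A) (d h))%R.

(** On the stabiliser of [A] the cocycle identity makes [coeff A (d g)] a homomorphism in [g] to
    [int], which kills elements of finite order. *)
Lemma cocycle_stabiliser g A : P2_act (val g) A = A -> coeff A (d g) = 0%R.
Proof.
move=> gA; have d1 : coeff A (d 1) = 0%R.
  apply: (addrI (coeff A (d 1))); rewrite addr0.
  by rewrite -[in RHS](mulg1 1) d_cocycle P2_act1.
have [m m_gt0 gm] := finite_subgroup_torsion finG (valP g).
have {}gm : g ^+ m = 1.
  by apply: val_inj; rewrite (multX (val : subgroup_of G -> Sinf)).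
have dX n : coeff A (d (g ^+ n)) = (coeff A (d g) *+ n)%R.
  by elim: n => [|n IHn] //; rewrite expgS d_cocycle gA IHn mulrS.
have /esym/eqP := dX m; rewrite gm d1.
by rewrite Num.Theory.mulrn_eq0 -[m == _]negbK -lt0n m_gt0 => /eqP.
Qed.

Lemma cocycle_coset g h A :
  P2_act (val g) A = P2_act (val h) A -> coeff A (d g) = coeff A (d h).
Proof.
move=> ghA; have kA : P2_act (val (g * h^-1)) A = A.
  by rewrite valM P2_actM ghA (multV (val : subgroup_of G -> Sinf)) P2_actK.
by rewrite -{1}(mulgVK h g) d_cocycle kA cocycle_stabiliser // add0r.
Qed.

(* The first cohomology of a permutation module vanishes: transport the cocycle
   from a base point of each orbit. *)
Lemma cocycle_coboundary : exists e : {freeg P2}, forall g A,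
  coeff A (d g) = (coeff (P2_act (val g) A) e - coeff A e)%R.
Proof.
pose orb A : set P2 := [set P2_act (val g) A | g in [set: subgroup_of G]].
pose b A := xget (P2_adj 0) (orb A).
have orb_act g A : orb (P2_act (val g) A) = orb A.
  apply/seteqP; split => B /= [h _ <-].
    by exists (g * h) => //; rewrite valM P2_actM.
  exists (g^-1 * h) => //.
  by rewrite valM P2_actM (multV (val : subgroup_of G -> Sinf)) P2_actK.
have bP A : exists g, P2_act (val g) (b A) = A.
  have [g _ gA] : orb A (b A) by apply: xgetPex; exists A, 1; rewrite ?P2_act1.
  exists g^-1; rewrite -gA.
  by rewrite (multV (val : subgroup_of G -> Sinf)) P2_actK.
have [h hE] := choice bP.
(* The value of the cocycle along [h A], which carries the base point to [A]; by [cocycle_coset] any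
   other such element gives the same value. *)
pose e A := coeff (b A) (d (h A)).
have [E EE] : exists E : {freeg P2}, forall A, coeff A E = e A.
  apply: freeg_of_finite.
  (* The support of [e] is covered by translates of the supports of the [d g], one for each [g] in
     the finite group [G]. *)
  pose F g := [set A | coeff (P2_act (val g)^-1 A) (d g) != 0%R].
  apply: (@sub_finite_set _ _ (\bigcup_(g in [set: subgroup_of G]) F g)) => [A /= eA|].
    by exists (h A) => //; rewrite /F /= (canLR (P2_actK _) (esym (hE A))).
  apply: bigcup_finite => [|g _].
    have -> : [set: subgroup_of G] = val @^-1` [set` G].
      by apply/seteqP; split => // g _; exact: (valP g).
    by apply: finite_preimage finG => g g' _ _; exact: val_inj.
  apply: (finite_preimage (f := P2_act (val g)^-1)) (freeg_finite (d g)).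
  by move=> A B _ _; exact: P2_act_inj.
have b_act g A : b (P2_act (val g) A) = b A by rewrite /b orb_act.
exists E => g A; rewrite !EE /e b_act.
rewrite (@cocycle_coset (h (P2_act (val g) A)) (h A * g)); last first.
  by rewrite valM P2_actM hE -[RHS]hE b_act.
by rewrite d_cocycle hE addrAC subrr add0r.
Qed.

End TwoSections.

(** Conjugating by the pure class with coordinates [e] adds twice the coboundary of [e] to the
    linking numbers of [s g]. *)
Theorem section_unique (G : subgroup Sinf)
    (s s' : {multiplicative subgroup_of G -> BinfQ}) : finite_subgroup G ->
    (forall g, p_map (s g) = val g) -> (forall g, p_map (s' g) = val g) ->
  exists2 a, a \in Pinf_ab & forall g, s' g = s g ^ a.
Proof.
move=> finG sE s'E; have [d [num_s' dM]] := section_diff sE s'E.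
have [e eE] := cocycle_coboundary finG dM.
have [a a1 aE] := lk_lift_freeg e; exists a; first by rewrite mem_Pinf_ab a1.
move=> g; apply: lk_map_eq => [|A].
  by rewrite (multJ p_map) /= a1 conjg1 sE s'E.
rewrite conjgE lk_num_pureM ?p_mapV ?a1 ?invg1 // !lk_mapM lk_mapV lk_numV lk_numM.
rewrite !lk_perm_map a1 invg1 P2_act1 sE !aE num_s' eE mulrBr.
by rewrite [RHS]addrC addrA.
Qed.

(** * Normalizers of finite subgroups *)

Section Normalizer.
Variable Gt : subgroup BinfQ.
Hypothesis finG : finite_subgroup Gt.

Let P := p_map @` [set` Gt].

(** If [u] normalizes [Gt], then [v ^ u] and [v] are elements of [Gt] over the same permutation,
    hence equal. *)
Lemma pure_normalizer u : p_map u = 1 ->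
  u \in normalizer Gt <-> forall v, v \in Gt -> commute u v.
Proof.
move=> u1; split => [/asboolP Nu v Gv|cGu].
  have Gvu : v ^ u \in Gt.
    by have : [set` Gt] (v ^ u) by rewrite -Nu; exists v.
  have vu : v ^ u = v.
    by apply: (p_map_inj_finite finG) => //; rewrite (multJ p_map) /= u1 conjg1.
  by rewrite /commute -{1}vu conjgE mulVKg.
have Ju v : v \in Gt -> v ^ u = v by move=> Gv; rewrite conjgE -cGu // mulKg.
apply/asboolP/seteqP; split => [_ [v Gv <-]|v Gv] /=; first by rewrite Ju.
by exists v => //; rewrite Ju.
Qed.

Lemma pure_commute u v : p_map u = 1 ->
  commute u v <->
  forall A, lk_num (lk_map u) (P2_act (p_map v) A) = lk_num (lk_map u) A.
Proof.
move=> u1; have numE A : lk_num (lk_map (v * u)) A =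
    (lk_num (lk_map v) A + lk_num (lk_map u) (P2_act (p_map v) A))%R.
  by rewrite lk_mapM lk_numM lk_perm_map.
split => [cuv A|inv_u].
  apply: (addrI (lk_num (lk_map v) A)).
  by rewrite -numE -cuv lk_num_pureM // addrC.
apply: lk_map_eq => [|A]; first by rewrite !p_mapM u1 mulg1 mul1g.
by rewrite lk_num_pureM // numE inv_u addrC.
Qed.

Lemma P2_orbit_act s A : P s -> P2_orbit P (P2_act s A) = P2_orbit P A.
Proof.
move=> [v Gv <-]; apply/seteqP; split => B [_ [w Gw <-] <-].
  exists (p_map (v * w)); first by exists (v * w) => //; exact: subMg.
  by rewrite p_mapM P2_actM.
exists (p_map (v^-1 * w)); first by exists (v^-1 * w) => //; apply/subMg/Gw/subVg.
by rewrite p_mapM p_mapV P2_actM P2_actK.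
Qed.

Fact P2_orbit_proof A : `[< exists B, P2_orbit P A = P2_orbit P B >].
Proof. by apply/asboolP; exists A. Qed.

Definition orbit_of A : P2_orbits P := Sub (P2_orbit P A) (P2_orbit_proof A).

(** The map [f] reads half the linking numbers at a representative [r O] of each orbit. It is onto
    because orbits are finite, so spreading coefficients over them preserves finite support. *)
Theorem normalizer_free :
  exists f : subgroup_of (inter_subgroup (normalizer Gt) Pinf_ab) ->
             {freeg (P2_orbits (p_map @` [set` Gt]))},
    iso_add f.
Proof.
pose N := subgroup_of (inter_subgroup (normalizer Gt) Pinf_ab).
have orb_id A : P2_orbit P A A.
  exists 1; last by rewrite P2_act1.
  by exists 1; [exact: sub1g | exact: p_map1].
have rP (O : P2_orbits P) : exists A, val O = P2_orbit P A.
  exact/asboolP/(valP O).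
have [r rE] := choice rP.
have r_orb A : exists2 s, P s & A = P2_act s (r (orbit_of A)).
  have := orb_id A; rewrite -[P2_orbit P A]/(val (orbit_of A)) rE.
  by move=> [s Ps e]; exists s.
have p1 (x : N) : p_map (val x) = 1.
  by apply/eqP; rewrite -mem_Pinf_ab; have /andP[] := valP x.
have inv_num (x : N) s A : P s ->
    lk_num (lk_map (val x)) (P2_act s A) = lk_num (lk_map (val x)) A.
  move=> [v Gv <-]; move: A; apply/pure_commute => //.
  have /andP[Nx _] := valP x; exact: (pure_normalizer (p1 x)).1.
have fP (x : N) : exists E : {freeg (P2_orbits P)}, forall O,
    lk_num (lk_map (val x)) (r O) = (2 * coeff O E)%R.
  have [D DE] := lk_num_pure (p1 x).
  suff [E EE] : exists E : {freeg (P2_orbits P)}, forall O, coeff O E = coeff (r O) D.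
    by exists E => O; rewrite DE EE.
  apply: freeg_of_finite; apply: (finite_preimage (f := r)) (freeg_finite D).
  by move=> O O' _ _ e; apply: val_inj; rewrite !rE e.
have [f fE] := choice fP; exists f; split; last first.
  move=> x y; apply/eqP/freeg_eqP => O; apply: double_inj.
  by rewrite -fE valM lk_num_pureM // coeffD mulrDr -!fE.
apply: inj_surj_bij => [x y fxy|E].
  apply: val_inj; apply: lk_map_eq => [|A]; first by rewrite !p1.
  by have [s Ps ->] := r_orb A; rewrite !inv_num // !fE fxy.
have [D DE] : exists D : {freeg P2}, forall A, coeff A D = coeff (orbit_of A) E.
  apply: freeg_of_finite.
  apply: (@sub_finite_set _ _ (\bigcup_(O in [set` dom E]) val O)) => [A /= EA|].
    by exists (orbit_of A); rewrite /= ?mem_dom.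
  apply: bigcup_finite; first exact: finite_seq.
  by move=> O _; rewrite rE; exact/finite_image/finite_image.
have [u u1 uE] := lk_lift_freeg D.
have Nu : u \in inter_subgroup (normalizer Gt) Pinf_ab.
  apply/andP; split; last by rewrite mem_Pinf_ab u1.
  apply/(pure_normalizer u1) => v Gv; apply/pure_commute => // A.
  rewrite !uE !DE; do 2!congr (_ _ _).
  by apply: val_inj; apply: P2_orbit_act; exists v.
exists (Sub u Nu); apply/eqP/freeg_eqP => O; apply: double_inj.
rewrite -fE SubK uE DE; do 2!congr (_ _ _).
by apply: val_inj; rewrite [RHS]rE.
Qed.

End Normalizer.

Theorem proposition17 :
  (* the extension *)
  [/\ {morph p_map : x y / x * y},
      (forall s : Sinf, exists x, p_map x = s)
    & forall x : BinfQ, (x \in Pinf_ab) = (p_map x == 1)]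
  /\
  (* the identification of Pinf_ab with Z[P2] *)
  (exists f : subgroup_of Pinf_ab -> {freeg P2},
    iso_add f /\
    forall (b : Binf) (i : nat) (x : subgroup_of Pinf_ab),
      val x = BinfQ_pi ((sigma i ^+ 2) ^ b) ->
      f x = free_basis (P2_act (Binf_perm b) (P2_adj i)))
  /\
  (* finite subgroups *)
  (forall Gt : subgroup BinfQ, finite_subgroup Gt ->
    odd (subgroup_order Gt) /\ set_bij [set` Gt] (p_map @` [set` Gt]) p_map)
  /\
  (* sections over finite subgroups of odd order *)
  (forall G : subgroup Sinf, finite_subgroup G -> odd (subgroup_order G) ->
    (exists s : {multiplicative subgroup_of G -> BinfQ},
       forall g, p_map (s g) = val g) /\
    forall s s' : {multiplicative subgroup_of G -> BinfQ},
      (forall g, p_map (s g) = val g) -> (forall g, p_map (s' g) = val g) ->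
      exists2 a, a \in Pinf_ab & forall g, s' g = s g ^ a)
  /\
  (* normalizers *)
  (forall Gt : subgroup BinfQ, finite_subgroup Gt ->
    exists f : subgroup_of (inter_subgroup (normalizer Gt) Pinf_ab) ->
               {freeg (P2_orbits (p_map @` [set` Gt]))},
      iso_add f).
Proof.
split; first by split; [exact: p_mapM | exact: p_map_surj | exact: mem_Pinf_ab].
split; first exact: Pinf_ab_free.
split; first exact: finite_subgroup_BinfQ.
split; last exact: normalizer_free.
move=> G finG oddG; split; first exact: section_exists.
by move=> s s'; exact: section_unique.
Qed.
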